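(* Let $\alpha>0$, $\varphi\in L^\infty(\mathbb{C}^n)$, and let $w$ be an $r$-doubling weight on $\mathbb{C}^n$ for some $r>0$. (1) For $1<p<\infty$, with $1/p+1/p'=1$, the Toeplitz operator $T_\varphi$ is bounded on $L^p_{\alpha,w}$ if and only if $$\sup_{Q:\,l(Q)=r}\left(\frac{1}{v(Q)}\int_Q w\,dv\right)\left(\frac{1}{v(Q)}\int_Q|\varphi|^{p'}w^{-\frac{p'}{p}}\,dv\right)^{\frac{p}{p'}}<\infty.$$ (2) $T_\varphi$ is bounded on $L^1_{\alpha,w}$ if and only if $$\sup_{Q:\,l(Q)=r}\left(\frac{1}{v(Q)}\int_Q w\,dv\right)\|\varphi w^{-1}\|_{L^\infty(Q)}<\infty.$$
   Context: Let $dv$ be Lebesgue measure on $\mathbb{C}^n$ and $\langle z,u\rangle=\sum_j z_j\overline{u_j}$. A weight on $\mathbb{C}^n$ is a nonnegative locally integrable function; $w(E)=\int_E w\,dv$. For $1\le p<\infty$, $L^p_{\alpha,w}$ is the space of measurable $f$ with $\|f\|^p_{L^p_{\alpha,w}}=\int_{\mathbb{C}^n}|f(z)|^pe^{-\frac{p\alpha}{2}|z|^2}w(z)\,dv(z)<\infty$. $Q$ denotes a cube in $\mathbb{C}^n\cong\mathbb{R}^{2n}$, $l(Q)$ its side length, and $Q_r(z)$ is the cube centered at $z$ with side length $r$. A weight $w$ is $r$-doubling if there is $C=C(r)\ge1$ with $w(Q_{2r}(z))\le C\,w(Q_r(z))$ for all $z\in\mathbb{C}^n$. The Toeplitz operator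 is $T_\varphi f=P_\alpha(\varphi f)$, i.e. $T_\varphi f(z)=\int_{\mathbb{C}^n}\varphi(u)f(u)e^{\alpha\langle z,u\rangle}\,d\lambda_\alpha(u)$, where $d\lambda_\alpha(u)=(\alpha/\pi)^ne^{-\alpha|u|^2}dv(u)$. That $T_\varphi$ is bounded on $L^p_{\alpha,w}$ means: for every $f\in L^p_{\alpha,w}$ the defining integral converges absolutely for $w\,dv$-almost every $z$, and $\|T_\varphi f\|_{L^p_{\alpha,w}}\le C\|f\|_{L^p_{\alpha,w}}$ with $C$ independent of $f$. Negative powers of $0$ are read as $\infty$, and $0\cdot\infty=0$. *)

(* Defs.v *)
From HB Require Import structures.
From mathcomp Require Import all_boot all_order all_algebra.
From mathcomp Require Import complex.
From mathcomp Require Import all_classical all_reals all_analysis ess_sup_inf.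

Set Implicit Arguments.
Unset Strict Implicit.
Unset Printing Implicit Defensive.

Import Order.TTheory GRing.Theory Num.Theory.
Import numFieldNormedType.Exports.

Local Open Scope classical_set_scope.
Local Open Scope ring_scope.
Local Open Scope complex_scope.

(* The library's product measure packaged as a sigma-finite measure: its
   canonical instance on [m1 \x m2] is restricted to subprobabilities. *)
Section sigma_finite_prod.
Context d1 d2 (T1 : measurableType d1) (T2 : measurableType d2) (R : realType).
Variable m1 : {sigma_finite_measure set T1 -> \bar R}.
Variable m2 : {sigma_finite_measure set T2 -> \bar R}.

Let prod := (m1 \x m2)%E.

HB.instance Definition _ := Measure.on prod.

Let prod_sigma_finite : sigma_finite setT prod.
Proof.
have /sigma_finiteP[F [TF ndF Foo]] := sigma_finiteT m1.
have /sigma_finiteP[G [TG ndG Goo]] := sigma_finiteT m2.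
exists (fun k => F k `*` G k).
  rewrite -setXTT TF TG predeqE => -[x y]; split.
    move=> [/= [i _ Fx] [j _ Gy]]; exists (maxn i j) => //; split.
    - by move: x Fx; exact/subsetPset/ndF/leq_maxl.
    - by move: y Gy; exact/subsetPset/ndG/leq_maxr.
  by move=> [k _ []/= ? ?]; split; exists k.
move=> k; have [? ?] := Foo k; have [? ?] := Goo k.
split; first exact: measurableX.
by rewrite /prod product_measure1E// lte_mul_pinfty// ge0_fin_numE.
Qed.

HB.instance Definition _ := Measure_isSigmaFinite.Build _ _ _ prod
  prod_sigma_finite.

Definition sigma_finite_prod :
  {sigma_finite_measure set (T1 * T2)%type -> \bar R} := prod.

End sigma_finite_prod.

(* Pushforward of a sigma-finite measure along a measurable map with a
   measurable left inverse (which keeps the image measure sigma-finite). *)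
Section transport.
Context d1 d2 (T1 : measurableType d1) (T2 : measurableType d2).
Context (R : realType).
Variables (mu : {sigma_finite_measure set T1 -> \bar R}).
Variables (f : T1 -> T2) (g : T2 -> T1).
Hypotheses (mf : measurable_fun setT f) (mg : measurable_fun setT g).
Hypothesis fK : cancel f g.

Let push : set T2 -> \bar R := pushforward mu f.

Let push0 : push set0 = 0%E.
Proof. by rewrite /push /pushforward preimage_set0 measure0. Qed.

Let push_ge0 A : (0 <= push A)%E.
Proof. exact: measure_ge0. Qed.

Let push_sigma_additive : semi_sigma_additive push.
Proof.
move=> F mF tF mUF; rewrite /push /pushforward preimage_bigcup.
apply: measure_semi_sigma_additive.
- by move=> n; rewrite -[X in measurable X]setTI; exact: mf.
- apply/trivIsetP => /= i j _ _ ij; rewrite -preimage_setI.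
  by move/trivIsetP : tF => /(_ _ _ _ _ ij) ->//; rewrite preimage_set0.
- by rewrite -preimage_bigcup -[X in measurable X]setTI; exact: mf.
Qed.

HB.instance Definition _ := isMeasure.Build _ _ _ push
  push0 push_ge0 push_sigma_additive.

Let push_sigma_finite : sigma_finite setT push.
Proof.
have [F TF Foo] := sigma_finiteT mu.
exists (fun k => g @^-1` F k); first by rewrite -preimage_bigcup -TF preimage_setT.
move=> k; have [mFk Fkoo] := Foo k; split.
  by rewrite -[X in measurable X]setTI; exact: mg.
rewrite /push /pushforward -comp_preimage (_ : g \o f = id) ?preimage_id//.
by apply/funext => x /=; rewrite fK.
Qed.

HB.instance Definition _ := Measure_isSigmaFinite.Build _ _ _ push
  push_sigma_finite.

Definition transport : {sigma_finite_measure set T2 -> \bar R} := push.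

End transport.

(* The n-fold product measure, as the iterated product of the library
   reassociated along T * n.-tuple T ~ n.+1.-tuple T. *)
Section tuple_measure.
Context d (T : measurableType d) (R : realType).
Variable mu : {sigma_finite_measure set T -> \bar R}.

Definition tcons n (xt : T * n.-tuple T) : n.+1.-tuple T :=
  [the n.+1.-tuple T of xt.1 :: xt.2].

Definition tuncons n (t : n.+1.-tuple T) : T * n.-tuple T :=
  (thead t, [tuple of behead t]).

Lemma measurable_tcons n : measurable_fun setT (@tcons n).
Proof. by apply: measurable_cons. Qed.

Lemma measurable_tuncons n : measurable_fun setT (@tuncons n).
Proof.
by apply: measurable_fun_pair; [exact: measurable_tnth|exact: measurable_behead].
Qed.

Lemma tconsK n : cancel (@tcons n) (@tuncons n).
Proof.
by move=> [x t]; congr (_, _); exact/val_inj.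
Qed.

Fixpoint tuple_measure n : {sigma_finite_measure set (n.-tuple T) -> \bar R} :=
  match n with
  | 0 => dirac [tuple]
  | m.+1 => transport
      (sigma_finite_prod mu (tuple_measure m))
      (@measurable_tcons m) (@measurable_tuncons m) (@tconsK m)
  end.

End tuple_measure.

Section complex_measure.
Variable R : realType.

HB.instance Definition _ := isPointed.Build R[i] 0.

Definition real_pair (z : R[i]) : measurableTypeR R * measurableTypeR R :=
  (complex.Re z, complex.Im z).

HB.instance Definition _ := Measurable.copy R[i]
  (g_sigma_algebra_preimageType real_pair).

Definition of_real_pair (xy : measurableTypeR R * measurableTypeR R) : R[i] :=
  xy.1 +i* xy.2.

Lemma of_real_pairK : cancel of_real_pair real_pair.
Proof. by case. Qed.

Lemma measurable_real_pair : measurable_fun setT real_pair.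
Proof. by move=> _ A mA; exists A. Qed.

Lemma measurable_of_real_pair : measurable_fun setT of_real_pair.
Proof.
move=> _ _ [A mA <-]; rewrite !setTI -comp_preimage.
by rewrite (_ : _ \o _ = id) ?preimage_id//; apply/funext; case.
Qed.

Definition complex_lebesgue : {sigma_finite_measure set R[i] -> \bar R} :=
  transport
    (sigma_finite_prod (@lebesgue_measure R) (@lebesgue_measure R))
    measurable_of_real_pair measurable_real_pair of_real_pairK.

End complex_measure.

Notation Cspace R n := (n.-tuple R[i]).

Section weights.
Variables (R : realType) (n : nat).
Local Notation Cn := (Cspace R n).

Definition vol : {sigma_finite_measure set Cn -> \bar R} :=
  tuple_measure (complex_lebesgue R) n.

Definition hdot (z u : Cn) : R[i] := \sum_(j < n) tnth z j * conjc (tnth u j).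

Definition sqnorm (z : Cn) : R := \sum_(j < n) Normc.normc (tnth z j) ^+ 2.

(* Lebesgue measurability. The library's sigma-algebra on C^n is the Borel
   one, and a function is Lebesgue measurable iff it coincides almost
   everywhere with a Borel function. *)
Definition lebesgue_measurable_fun d (T : measurableType d) (f : Cn -> T) :=
  exists2 g : Cn -> T, measurable_fun setT g & {ae vol, forall z, f z = g z}.

Definition cube (z : Cn) (s : R) : set Cn :=
  [set u | forall j : 'I_n,
     `|complex.Re (tnth u j) - complex.Re (tnth z j)| <= s / 2 /\
     `|complex.Im (tnth u j) - complex.Im (tnth z j)| <= s / 2].

Definition average (Q : set Cn) (g : Cn -> \bar R) : \bar R :=
  ((fine (vol Q))^-1%:E * \int[vol]_(z in Q) g z)%E.

Definition wmeas (w : Cn -> R) (E : set Cn) : \bar R :=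
  (\int[vol]_(z in E) (w z)%:E)%E.

Definition is_weight (w : Cn -> R) :=
  [/\ lebesgue_measurable_fun w,
      forall z, 0 <= w z &
      forall z s, (wmeas w (cube z s) < +oo)%E].

Definition r_doubling (r : R) (w : Cn -> R) :=
  exists2 C : R, 1 <= C &
    forall z, (wmeas w (cube z (2 * r)) <= C%:E * wmeas w (cube z r))%E.

Definition Linfty (phi : Cn -> R[i]) :=
  lebesgue_measurable_fun phi /\
  (ess_sup vol (fun z => (Normc.normc (phi z))%:E) < +oo)%E.

(* t^a for t >= 0, with 0^a = +oo when a < 0 (the library's [0 `^ a] is 0
   for every a != 0). *)
Definition epow (t a : R) : \bar R :=
  if (t == 0) && (a < 0) then +oo%E else (t `^ a)%:E.

End weights.

Section toeplitz.
Variables (R : realType) (n : nat) (alpha : R).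
Local Notation Cn := (Cspace R n).

Definition fock_int (p : R) (w : Cn -> R) (f : Cn -> R[i]) : \bar R :=
  (\int[vol R n]_z (Normc.normc (f z) `^ p *
                    expR (- (p * alpha / 2 * sqnorm z)) * w z)%:E)%E.

Definition fock_norm (p : R) (w : Cn -> R) (f : Cn -> R[i]) : \bar R :=
  (fock_int p w f `^ p^-1)%E.

Definition in_fock (p : R) (w : Cn -> R) (f : Cn -> R[i]) :=
  lebesgue_measurable_fun f /\ (fock_int p w f < +oo)%E.

Definition cexp (z : R[i]) : R[i] :=
  (expR (complex.Re z))%:C * (cos (complex.Im z) +i* sin (complex.Im z)).

(* Density of lambda_alpha with respect to Lebesgue measure. *)
Definition gauss (u : Cn) : R :=
  (alpha / pi) ^+ n * expR (- (alpha * sqnorm u)).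

Definition toeplitz_integrand (phi f : Cn -> R[i]) (z u : Cn) : R[i] :=
  phi u * f u * cexp (alpha%:C * hdot z u) * (gauss u)%:C.

Definition toeplitz_cvg (phi f : Cn -> R[i]) (z : Cn) :=
  (\int[vol R n]_u (Normc.normc (toeplitz_integrand phi f z u))%:E < +oo)%E.

(* Junk value where toeplitz_cvg fails; toeplitz_bounded requires that set to be
   w dv-null, so it does not contribute to fock_norm. *)
Definition toeplitz (phi f : Cn -> R[i]) (z : Cn) : R[i] :=
  (\int[vol R n]_u complex.Re (toeplitz_integrand phi f z u))%R +i*
  (\int[vol R n]_u complex.Im (toeplitz_integrand phi f z u))%R.

Definition toeplitz_bounded (p : R) (w : Cn -> R) (phi : Cn -> R[i]) :=
  exists2 C : R, 0 <= C &
    forall f, in_fock p w f ->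
      {ae wmeas w, forall z, toeplitz_cvg phi f z} /\
      (fock_norm p w (toeplitz phi f) <= C%:E * fock_norm p w f)%E.

End toeplitz.

(* Main.v *)
From mathcomp Require Import all_boot all_order all_algebra.
From mathcomp Require Import complex.
From mathcomp Require Import all_classical all_reals all_analysis ess_sup_inf measurable_realfun.
From mathcomp Require Import ring lra.
Require Import Defs.

(** Write [K(z, u) = exp (- alpha |z - u|^2 / 2)] and, for a function [f],
[g = |f| exp (- alpha |u|^2 / 2)]. Completing the square in the reproducing kernel
(gaussian_exponent) gives
[|T f(z)| exp (- alpha |z|^2 / 2) <= c int K(z, u) |phi(u)| g(u) dv(u)],
and the Fock norm of [f] is the norm of [g] in [L^p(w dv)]. So the question is
about a positive operator with a Gaussian kernel, which lives at a single scale: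
what happens in cubes of side [r] decides everything.

Sufficiency. Let [W(z) = w(Q_r(z))]. A cube of side [(m + 1) r] is an average
of cubes of side [r] (cube_averaging, a use of Tonelli's theorem), so integrals
over cubes of side [r] with at most geometric growth control those over all
cubes, and the Gaussian beats any geometric growth (kern_growth). For a doubling
weight this gives [int K(z, u) w(u) dv(u) <= M W(z)] (kern_weight_le). Now
factor [|phi| g] as the product of [g (w / W)^(1/p)] and
[|phi| (W / w)^(1/p)] and apply Hoelder's inequality for the measure
[K(z, u) dv(u)]. The cube condition says that the second factor to the power [p']
has bounded integrals over the cubes of side [r], so its integral against the
kernel is bounded in [z] (kop_bounded_gt1). The first one is integrated against
[w(z) dv(z)] with Tonelli's theorem, and [kern_weight_le] absorbs the [1 / W]
(kern_schur). For [p = 1] the second factor is simply bounded. If [W] vanishes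
somewhere then [w] is 0 almost everywhere and there is nothing to prove.

Necessity. Given a cube [Q = Q_r(x)] and a density [psi >= 0], test the operator
on the function supported in [Q] with [g = psi] whose phase cancels that of [phi]
and that of [exp (alpha <y, u>)]. For [z] in a small cube around [y] the phase of
the integrand is, up to a constant, [alpha Im <z - y, u - y>], which is small, so
there is no cancellation and the weighted [|T f(z)|] is at least a constant times
the integral of [|phi| psi] over [Q]. This bounds the mass of the small cube
around [y]; averaging over [y] yields (toeplitz_bounded_test)
[w(Q) (int_Q |phi| psi)^p <= K int_Q psi^p w].
The choice [psi = (|phi| / w)^(p'/p)], suitably truncated, makes both integrals
equal and gives the cube condition for [p > 1]; indicators of sets give it for
[p = 1].

The functions involved are Borel only up to null sets. Since integrals of
nonnegative functions are suprema over simple functions, they are monotone and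
insensitive to null sets for arbitrary functions (ae_le_lower_integral), which
reduces everything to Borel representatives. *)

Set Implicit Arguments.
Unset Strict Implicit.
Unset Printing Implicit Defensive.
Import Order.TTheory GRing.Theory Num.Theory.
Import numFieldNormedType.Exports.
Import HBNNSimple.
Local Open Scope classical_set_scope.
Local Open Scope ring_scope.
Local Open Scope complex_scope.

(** * Integrals of arbitrary nonnegative functions *)

Section lower_integral_aux.
Context (R : realType).
Local Open Scope ereal_scope.

Lemma abse_sub_le (a b c : \bar R) :
  0 <= a -> 0 <= b -> a <= c -> b <= c -> `|a - b| <= c.
Proof.
move: a b c => [a| |] [b| |] [c| |] //=; rewrite ?leey// !lee_fin => *.
by rewrite ler_norml; apply/andP; split; lra.
Qed.

End lower_integral_aux.

Section lower_integral.
Context d (T : measurableType d) (R : realType).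
Variable mu : {measure set T -> \bar R}.
Local Open Scope ereal_scope.

(** The integral of a nonnegative function is the supremum of the integrals of
the simple functions below it, so it makes sense and is monotone for every
function; a simple function set to 0 on a null set keeps its integral. This is
what allows [w], [phi], [f] and [toeplitz alpha phi f] to be compared with Borel
functions. *)
Lemma ae_le_lower_integral (D : set T) (f g : T -> \bar R) :
  (forall x, D x -> 0 <= f x) -> (forall x, D x -> 0 <= g x) ->
  {ae mu, forall x, D x -> f x <= g x} ->
  \int[mu]_(x in D) f x <= \int[mu]_(x in D) g x.
Proof.
move=> f0 g0 [N [mN muN sub]].
rewrite !ge0_integralE//; apply: ge_ereal_sup => _ [h hf <-].
pose h' := proj_nnsfun h (measurableC mN).
have h'E x : h' x = (h x * \1_(~` N) x)%R by [].
have <- : sintegral mu h' = sintegral mu h.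
  rewrite -!integralT_nnsfun; apply: ge0_ae_eq_integral => //.
  - exact/measurable_EFinP.
  - exact/measurable_EFinP.
  - by move=> x _; rewrite lee_fin.
  - by move=> x _; rewrite lee_fin.
  exists N; split=> // x /=; apply: contra_notP => Nx _.
  by rewrite mindicE mem_set// mulr1.
apply: ereal_sup_ubound; exists h' => // x.
rewrite h'E indicE; have [Nx|Nx] := boolP (x \in ~` N).
  rewrite mulr1; have := hf x; rewrite /patch; case: ifPn => // /set_mem Dx.
  move=> /le_trans; apply; apply: contrapT => /negP fg.
  by move: (set_mem Nx); apply; apply: sub => /= /(_ Dx); exact/negP.
by rewrite mulr0 /patch; case: ifPn => // /set_mem /g0.
Qed.

Lemma le_lower_integral (D : set T) (f g : T -> \bar R) :
  (forall x, D x -> 0 <= f x) -> (forall x, D x -> f x <= g x) ->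
  \int[mu]_(x in D) f x <= \int[mu]_(x in D) g x.
Proof.
move=> f0 fg; apply: ae_le_lower_integral => //.
  by move=> x Dx; exact: le_trans (f0 _ Dx) (fg _ Dx).
exact: aeW.
Qed.

Lemma ae_eq_lower_integral (D : set T) (f g : T -> \bar R) :
  (forall x, D x -> 0 <= f x) -> (forall x, D x -> 0 <= g x) ->
  {ae mu, forall x, D x -> f x = g x} ->
  \int[mu]_(x in D) f x = \int[mu]_(x in D) g x.
Proof.
move=> f0 g0 fg; apply/eqP; rewrite eq_le !ae_le_lower_integral//.
- by apply: filterS fg => x + Dx => ->.
- by apply: filterS fg => x + Dx => ->.
Qed.

Lemma ae_eq_signed_lower_integral (D : set T) (f g : T -> \bar R) :
  {ae mu, forall x, D x -> f x = g x} ->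
  \int[mu]_(x in D) f x = \int[mu]_(x in D) g x.
Proof.
move=> fg; rewrite integralE [RHS]integralE; congr (_ - _);
  apply: ae_eq_lower_integral => //; apply: filterS fg => x + Dx => /(_ Dx).
- by rewrite !funeposE => ->.
- by rewrite !funenegE => ->.
Qed.

(** The positive and negative parts of [f] both have their integral in
[[0, int |f|]], which bounds the difference whatever conventions infinite values
and non-measurable functions are given. *)
Lemma abse_lower_integral_le (D : set T) (f : T -> \bar R) :
  `| \int[mu]_(x in D) f x | <= \int[mu]_(x in D) `|f x|.
Proof.
have p : \int[mu]_(x in D) f^\+ x <= \int[mu]_(x in D) `|f x|.
  by apply: le_lower_integral => // x _;
    have /(congr1 (@^~ x)) /= -> := fune_abse f; rewrite leeDl.
have m : \int[mu]_(x in D) f^\- x <= \int[mu]_(x in D) `|f x|.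
  by apply: le_lower_integral => // x _;
    have /(congr1 (@^~ x)) /= -> := fune_abse f; rewrite leeDr.
have p0 : 0 <= \int[mu]_(x in D) f^\+ x by exact: integral_ge0.
have m0 : 0 <= \int[mu]_(x in D) f^\- x by exact: integral_ge0.
by rewrite integralE; exact: abse_sub_le.
Qed.

End lower_integral.

(** * Measurability of complex-valued functions *)

Section complex_measurability.
Variable R : realType.

Lemma measurable_complexRe : measurable_fun setT (@complex.Re R).
Proof.
by apply: (measurableT_comp measurable_fst (measurable_real_pair (R:=R))).
Qed.

Lemma measurable_complexIm : measurable_fun setT (@complex.Im R).
Proof.
by apply: (measurableT_comp measurable_snd (measurable_real_pair (R:=R))).
Qed.

Context d (T : measurableType d).

Lemma measurable_complexP (f : T -> R[i]) :
  measurable_fun setT (fun x => complex.Re (f x) : R) ->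
  measurable_fun setT (fun x => complex.Im (f x) : R) ->
  measurable_fun setT f.
Proof.
move=> mr mi.
have -> : f = @of_real_pair R \o (fun x => (complex.Re (f x), complex.Im (f x))).
  by apply/funext => x /=; rewrite /of_real_pair /=; case: (f x).
apply: measurableT_comp; first exact: measurable_of_real_pair.
exact: measurable_fun_pair.
Qed.

Lemma measurable_Re_comp (f : T -> R[i]) : measurable_fun setT f ->
  measurable_fun setT (fun x => complex.Re (f x) : R).
Proof. by move=> mf; exact: measurableT_comp measurable_complexRe mf. Qed.

Lemma measurable_Im_comp (f : T -> R[i]) : measurable_fun setT f ->
  measurable_fun setT (fun x => complex.Im (f x) : R).
Proof. by move=> mf; exact: measurableT_comp measurable_complexIm mf. Qed.

Lemma normcE (z : R[i]) :
  Normc.normc z = Num.sqrt (complex.Re z ^+ 2 + complex.Im z ^+ 2).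
Proof. by case: z. Qed.

Lemma normc_ge0 (z : R[i]) : 0 <= Normc.normc z.
Proof. by rewrite normcE sqrtr_ge0. Qed.

Lemma measurable_inv_ge0 (f : T -> R) : measurable_fun setT f ->
  (forall x, 0 <= f x) -> measurable_fun setT (fun x => (f x)^-1).
Proof.
move=> mf f0; under eq_fun do rewrite -powR_inv1//.
exact: (measurableT_comp (measurable_powR (-1))).
Qed.

Lemma measurable_normc_comp (f : T -> R[i]) : measurable_fun setT f ->
  measurable_fun setT (fun x => Normc.normc (f x) : R).
Proof.
move=> mf; under eq_fun do rewrite normcE -powR12_sqrt ?addr_ge0 ?sqr_ge0//.
apply: (measurableT_comp (measurable_powR (2^-1))).
by apply: measurable_funD; apply: measurable_funX;
  [exact: measurable_Re_comp|exact: measurable_Im_comp].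
Qed.

Lemma measurable_mulc (f g : T -> R[i]) : measurable_fun setT f ->
  measurable_fun setT g -> measurable_fun setT (fun x => f x * g x).
Proof.
move=> mf mg.
have [mfr mfi] := (measurable_Re_comp mf, measurable_Im_comp mf).
have [mgr mgi] := (measurable_Re_comp mg, measurable_Im_comp mg).
apply: measurable_complexP.
- have -> : (fun x => complex.Re (f x * g x)) = (fun x => complex.Re (f x) *
    complex.Re (g x) - complex.Im (f x) * complex.Im (g x)).
    by apply/funext => x; case: (f x) => ? ?; case: (g x).
  by apply: measurable_funB; exact: measurable_funM.
- have -> : (fun x => complex.Im (f x * g x)) = (fun x => complex.Re (f x) *
    complex.Im (g x) + complex.Im (f x) * complex.Re (g x)).
    by apply/funext => x; case: (f x) => ? ?; case: (g x).
  by apply: measurable_funD; exact: measurable_funM.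
Qed.

Lemma measurable_Re_tnth n (i : 'I_n) (f : T -> Cspace R n) :
  measurable_fun setT f ->
  measurable_fun setT (fun x => complex.Re (tnth (f x) i) : R).
Proof.
by move=> mf; apply: measurable_Re_comp; exact: (measurableT_comp (measurable_tnth i)).
Qed.

Lemma measurable_Im_tnth n (i : 'I_n) (f : T -> Cspace R n) :
  measurable_fun setT f ->
  measurable_fun setT (fun x => complex.Im (tnth (f x) i) : R).
Proof.
by move=> mf; apply: measurable_Im_comp; exact: (measurableT_comp (measurable_tnth i)).
Qed.

End complex_measurability.

(** * Cubes and their volume *)

Section cube_volume.
Variable R : realType.

(** Together with Tonelli's theorem, the volume of cubes is all that the estimates
below draw from the product measure. *)
Lemma tuple_measure_box d (T : measurableType d)
    (mu : {sigma_finite_measure set T -> \bar R}) n (A : 'I_n -> set T) (c : R) :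
  (forall j, measurable (A j)) -> (forall j, mu (A j) = c%:E) ->
  tuple_measure mu n [set t | forall j, A j (tnth t j)] = (c ^+ n)%:E.
Proof.
elim: n A => [A _ _|n IH A mA Ac].
  rewrite /= /dirac /= indicE mem_set ?expr0// => -[].
  by case.
rewrite /= /pushforward.
have -> : @tcons _ _ n @^-1` [set t | forall j, A j (tnth t j)] =
    A ord0 `*` [set t | forall j, A (lift ord0 j) (tnth t j)].
  apply/seteqP; split=> [[x t] /= Ht|[x t] /= [Ax At] j].
    split; first by have := Ht ord0.
    by move=> j; rewrite -(tnthS x t j); exact: Ht.
  have [->//|j0] := eqVneq j ord0.
  have [k ->] : exists k, j = lift ord0 k.
    by case: (unliftP ord0 j) j0 => [k -> _|-> /eqP//]; exists k.
  by rewrite [tnth _ _](tnthS x t k); exact: At.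
have mB : measurable [set t : n.-tuple T | forall j, A (lift ord0 j) (tnth t j)].
  rewrite (_ : [set t | _] = \bigcap_(j in [set: 'I_n])
     ((fun t : n.-tuple T => tnth t j) @^-1` A (lift ord0 j))).
    apply: fin_bigcap_measurable => // j _.
    by rewrite -[X in measurable X]setTI; exact: measurable_tnth.
  by apply/seteqP; split=> t /= H; [move=> j _|move=> j]; exact: H.
set B := [set t | _] in mB *.
transitivity (mu (A ord0) * tuple_measure mu n B)%E.
  by apply: product_measure1E.
have -> : tuple_measure mu n B = (c ^+ n)%:E by exact: (IH (fun j => A (lift ord0 j))).
by rewrite Ac -EFinM -exprS.
Qed.

Definition square (a : R[i]) (s : R) : set R[i] :=
  [set z | `|complex.Re z - complex.Re a| <= s / 2 /\
           `|complex.Im z - complex.Im a| <= s / 2].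

Lemma preimage_square a s : @of_real_pair R @^-1` square a s =
  `[complex.Re a - s / 2, complex.Re a + s / 2]%classic `*`
  `[complex.Im a - s / 2, complex.Im a + s / 2]%classic.
Proof.
by apply/seteqP; split=> -[x y]; rewrite /square /= !in_itv/= !ler_distl => -[-> ->].
Qed.

Lemma measurable_square a s : measurable (square a s).
Proof.
exists (`[complex.Re a - s / 2, complex.Re a + s / 2]%classic `*`
  `[complex.Im a - s / 2, complex.Im a + s / 2]%classic).
  by apply: measurableX; exact: measurable_itv.
by apply/seteqP; split=> z; rewrite /square /= !in_itv/= !ler_distl;
  [move=> [_ [-> ->]]|move=> [-> ->]].
Qed.

Lemma complex_lebesgue_square a s : 0 <= s ->
  complex_lebesgue R (square a s) = (s ^+ 2)%:E.
Proof.
move=> s0; rewrite /complex_lebesgue /= /pushforward preimage_square.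
transitivity
  (lebesgue_measure `[(complex.Re a - s / 2)%R, (complex.Re a + s / 2)%R]%classic *
   lebesgue_measure `[(complex.Im a - s / 2)%R, (complex.Im a + s / 2)%R]%classic)%E.
  by apply: product_measure1E; exact: measurable_itv.
rewrite !lebesgue_measure_itv/= !lte_fin.
have [->|sn0] := eqVneq s 0; first by rewrite mul0r !subr0 !addr0 !ltxx mule0 expr0n.
have {}s0 : 0 < s by rewrite lt_def sn0.
by rewrite !ifT; [rewrite -EFinB -EFinB -EFinM; congr _%:E; field|lra|lra].
Qed.

Variable n : nat.
Local Notation Cn := (Cspace R n).

Lemma cubeE (z : Cn) s :
  cube z s = [set u | forall j, square (tnth z j) s (tnth u j)].
Proof. by []. Qed.

Lemma cube_sym (z u : Cn) s : cube z s u -> cube u s z.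
Proof. by move=> H j; have [] := H j; rewrite !(distrC (_ (tnth u _))). Qed.

Lemma le_cube (z : Cn) s t : s <= t -> cube z s `<=` cube z t.
Proof. by move=> st u zu j; have [] := zu j; split; lra. Qed.

(** Triangle inequality for half the sup-distance: side lengths play the part of
distances. *)
Lemma cube_trans (z x u : Cn) s t : cube z s x -> cube x t u ->
  cube z (s + t) u.
Proof.
move=> zx xu j; have [a b] := zx j; have [c e] := xu j; split.
- by rewrite (le_trans (ler_distD (complex.Re (tnth x j)) _ _))//; lra.
- by rewrite (le_trans (ler_distD (complex.Im (tnth x j)) _ _))//; lra.
Qed.

Lemma vol_cube (z : Cn) s : 0 <= s -> vol R n (cube z s) = ((s ^+ 2) ^+ n)%:E.
Proof.
move=> s0; rewrite cubeE /vol.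
apply: (tuple_measure_box (A := fun j => square (tnth z j) s)) => j.
- exact: measurable_square.
- exact: complex_lebesgue_square.
Qed.

Lemma measurable_cube_rel d (T : measurableType d) (f g : T -> Cn) s :
  measurable_fun setT f -> measurable_fun setT g ->
  measurable [set x | cube (f x) s (g x)].
Proof.
move=> mf mg; rewrite (_ : [set x | _] = \bigcap_(j in [set: 'I_n])
  ([set x | `|complex.Re (tnth (g x) j) - complex.Re (tnth (f x) j)| <= s / 2] `&`
   [set x | `|complex.Im (tnth (g x) j) - complex.Im (tnth (f x) j)| <= s / 2])).
  apply: fin_bigcap_measurable => // j _; apply: measurableI.
  - rewrite -[X in measurable X]setTI; apply: measurable_fun_le => //.
    apply: (measurableT_comp (@normr_measurable _ setT)).
    by apply: measurable_funB; exact: measurable_Re_tnth.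
  - rewrite -[X in measurable X]setTI; apply: measurable_fun_le => //.
    apply: (measurableT_comp (@normr_measurable _ setT)).
    by apply: measurable_funB; exact: measurable_Im_tnth.
by apply/seteqP; split=> x /= H; [move=> j _|move=> j]; exact: H.
Qed.

Lemma measurable_cube (z : Cn) s : measurable (cube z s).
Proof. exact: (@measurable_cube_rel _ _ (fun=> z) id). Qed.

End cube_volume.

(** * Averaging over cubes *)

Section cube_averaging.
Variables (R : realType) (n : nat).
Local Notation Cn := (Cspace R n).
Local Open Scope ereal_scope.

Lemma integral_indicr d (T : measurableType d)
    (mu : {measure set T -> \bar R}) (A : set T) (H : T -> \bar R) :
  \int[mu]_x (H x * (\1_A x)%:E) = \int[mu]_(x in A) H x.
Proof. by rewrite [RHS]integral_mkcond epatch_indic. Qed.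

Lemma measurable_indic_comp d1 d2 (T1 : measurableType d1)
    (T2 : measurableType d2) (f : T1 -> T2) (A : set T2) :
  measurable A -> measurable_fun setT f ->
  measurable_fun setT (fun x => (\1_A (f x))%:E : \bar R).
Proof.
move=> mA mf; apply/measurable_EFinP.
rewrite (_ : (fun x => _) = \1_(f @^-1` A)) //; apply: measurable_indic.
by rewrite -[X in measurable X]setTI; exact: mf.
Qed.

(** A large cube is covered in the mean by small ones: every point [u] of
[cube z s] lies in [cube x t] for a set of centres [x] of measure [t^(2n)], and
all these centres are in [cube z (s + t)], so Tonelli's theorem applied to
[(x, u) |-> H u] on [u \in cube z s], [u \in cube x t] compares the two
sides. This replaces coverings by a grid of cubes. *)
Lemma cube_averaging (H : Cn -> \bar R) z (s t : R) (B : \bar R) :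
  (0 <= s)%R -> (0 <= t)%R -> measurable_fun setT H -> (forall u, 0 <= H u) ->
  0 <= B -> (forall x, cube z (s + t) x -> \int[vol R n]_(u in cube x t) H u <= B) ->
  ((t ^+ 2) ^+ n)%:E * \int[vol R n]_(u in cube z s) H u <=
  (((s + t) ^+ 2) ^+ n)%:E * B.
Proof.
move=> s0 t0 mH H0 B0 HB.
pose E := [set xu : Cn * Cn | cube xu.1 t xu.2].
have mE : measurable E by apply: (@measurable_cube_rel _ _ _ _ fst snd).
pose F (xu : Cn * Cn) := H xu.2 * (\1_(cube z s) xu.2)%:E * (\1_E xu)%:E.
have F0 xu : 0 <= F xu by rewrite !mule_ge0 ?lee_fin ?H0.
have mF : measurable_fun setT F.
  apply: emeasurable_funM; last by apply: (measurable_indic_comp (f := id)).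
  apply: emeasurable_funM; first exact: (measurableT_comp mH).
  by apply: (measurable_indic_comp (f := snd)); first exact: measurable_cube.
have <- : \int[vol R n]_u \int[vol R n]_x F (x, u) =
    ((t ^+ 2) ^+ n)%:E * \int[vol R n]_(u in cube z s) H u.
  rewrite -(integral_indicr _ (cube z s) H) muleC -ge0_integralZr//; last 3 first.
  - apply: emeasurable_funM => //.
    by apply: (measurable_indic_comp (f := id)); first exact: measurable_cube.
  - by move=> u _; rewrite mule_ge0 ?lee_fin.
  - by rewrite lee_fin !exprn_ge0.
  apply: eq_integral => u _; rewrite /F /=.
  rewrite ge0_integralZl//; last 2 first.
  - by apply: (@measurable_indic_comp _ _ _ _ (fun x : Cn => (x, u)) E).
  - by rewrite mule_ge0 ?lee_fin.
  congr (_ * _); rewrite -(vol_cube u t0) -[RHS]mul1e -integral_cst//.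
    rewrite -(integral_indicr _ (cube u t)); apply: eq_integral => x _.
    rewrite mul1e !indicE (_ : ((x, u) \in E) = (x \in cube u t))//.
    by apply/idP/idP => /set_mem xu; apply/mem_set; exact: cube_sym.
  exact: measurable_cube.
rewrite -(fubini_tonelli F)//.
have -> : (((s + t) ^+ 2) ^+ n)%:E * B =
    \int[vol R n]_(x in cube z (s + t)) (cst B x).
  rewrite integral_cst; last exact: measurable_cube.
  by rewrite muleC; congr (_ * _); exact/esym/vol_cube/addr_ge0.
rewrite -(integral_indicr _ (cube z (s + t))).
apply: le_lower_integral => [x _|x _].
  exact: integral_ge0.
rewrite indicE; have [/set_mem xz|xz] := boolP (x \in cube z (s + t)).
  rewrite mule1; apply: (@le_trans _ _ (\int[vol R n]_(u in cube x t) H u)).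
    rewrite -(integral_indicr _ (cube x t)).
    apply: le_lower_integral => u _; first exact: F0.
    rewrite /F /= !indicE (_ : (x, u) \in E = (u \in cube x t))//.
    rewrite lee_wpmul2r ?lee_fin//.
    by case: (u \in _); rewrite ?mule1// mule0.
  exact: HB.
rewrite mule0 integral0_eq// => u _; rewrite /F /= !indicE.
have [/set_mem zu|] := boolP (u \in cube z s); last by rewrite mule0 mul0e.
have [/set_mem xu|] := boolP ((x, u) \in E); last by rewrite mule0.
by move/negP: xz; case; apply/mem_set; apply: cube_trans zu _; exact: cube_sym.
Qed.

End cube_averaging.

(** * The Gaussian kernel against functions of geometric growth *)

Section gaussian_kernel.
Variables (R : realType) (n : nat) (alpha r : R).
Hypotheses (alpha_gt0 : 0 < alpha) (r_gt0 : 0 < r).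
Local Notation Cn := (Cspace R n).

Definition sqdist (z u : Cn) : R := \sum_(j < n)
  ((complex.Re (tnth z j) - complex.Re (tnth u j)) ^+ 2 +
   (complex.Im (tnth z j) - complex.Im (tnth u j)) ^+ 2).

Definition kern (z u : Cn) : R := expR (- (alpha / 2 * sqdist z u)).

Lemma sqdist_sym z u : sqdist z u = sqdist u z.
Proof.
by apply: eq_bigr => j _; rewrite -(sqrrN (_ - _)) opprB -(sqrrN (complex.Im _ - _)) opprB.
Qed.

Lemma kern_sym z u : kern z u = kern u z.
Proof. by rewrite /kern sqdist_sym. Qed.

Lemma kern_gt0 z u : 0 < kern z u.
Proof. exact: expR_gt0. Qed.

Lemma sqdist_ge0 z u : 0 <= sqdist z u.
Proof. by apply: sumr_ge0 => j _; rewrite addr_ge0 ?sqr_ge0. Qed.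

Lemma measurable_sqdist d (T : measurableType d) (f g : T -> Cn) :
  measurable_fun setT f -> measurable_fun setT g ->
  measurable_fun setT (fun x => sqdist (f x) (g x)).
Proof.
move=> mf mg; apply: measurable_sum => j; apply: measurable_funD;
  apply: measurable_funX; apply: measurable_funB;
  by [exact: measurable_Re_tnth|exact: measurable_Im_tnth].
Qed.

Lemma measurable_kern d (T : measurableType d) (f g : T -> Cn) :
  measurable_fun setT f -> measurable_fun setT g ->
  measurable_fun setT (fun x => kern (f x) (g x)).
Proof.
move=> mf mg; apply: (measurableT_comp (@measurable_expR _)).
apply: measurableT_comp => //; apply: measurable_funM => //.
exact: measurable_sqdist.
Qed.

Lemma sqdist_outside_cube z u s : 0 <= s -> ~ cube z s u ->
  (s / 2) ^+ 2 <= sqdist z u.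
Proof.
move=> s0; apply: contra_notP => /negP; rewrite -ltNge => zu j.
have zuj : (complex.Re (tnth z j) - complex.Re (tnth u j)) ^+ 2 +
    (complex.Im (tnth z j) - complex.Im (tnth u j)) ^+ 2 < (s / 2) ^+ 2.
  apply: le_lt_trans zu; rewrite /sqdist (bigD1 j)//= lerDl sumr_ge0// => i _.
  by rewrite addr_ge0 ?sqr_ge0.
by split; rewrite distrC -(@ler_pXn2r _ 2) ?nnegrE ?divr_ge0// real_normK ?num_real//;
  apply: le_trans (ltW zuj); rewrite ?lerDl ?lerDr sqr_ge0.
Qed.

Lemma cube_exhausts (z u : Cn) : exists m : nat, cube z (m.+1%:R * r) u.
Proof.
have d0 := sqdist_ge0 z u.
exists (Num.truncn (2 * (sqdist z u + 1) / r)).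
set m := Num.truncn _.
have mr : 2 * (sqdist z u + 1) < m.+1%:R * r.
  by rewrite -ltr_pdivrMr// /m truncnS_gt.
apply: contrapT => nc.
have mr0 : 0 <= m.+1%:R * r by rewrite mulr_ge0 ?ltW.
have := sqdist_outside_cube mr0 nc; move: mr d0.
move: (_ * r) (sqdist z u) => a b ab b0 ba; nra.
Qed.

(** A Gaussian decays faster than any geometric sequence. The index [m] is the
first one for which [cube z ((m + 1) r)] contains [u]; then [u] is at distance
at least [m r / 2] from [z], so the kernel is at most [expR (- a m^2)] with
[a = alpha r^2 / 8], and [m ln G - a m^2 <= (ln G)^2 / (4 a)] by completing the
square. *)
Lemma kern_decay (G : R) : 0 < G -> exists2 M : R, 0 < M &
  forall z u, exists2 m, cube z (m.+1%:R * r) u & kern z u <= M * G ^- m.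
Proof.
move=> G0; pose a := alpha * r ^+ 2 / 8.
have a0 : 0 < a by rewrite /a divr_gt0 ?mulr_gt0 ?exprn_gt0.
exists (expR (ln G ^+ 2 / (4 * a))); first exact: expR_gt0.
move=> z u; have ex : exists m, `[< cube z (m.+1%:R * r) u >].
  by have [m zu] := cube_exhausts z u; exists m; apply/asboolP.
case: (ex_minnP ex) => m /asboolP zu mmin; exists m => //.
have far : (m%:R * r / 2) ^+ 2 <= sqdist z u.
  case: m mmin {zu} => [_|m mmin]; first by rewrite !mul0r expr0n sqdist_ge0.
  apply: sqdist_outside_cube; first by rewrite mulr_ge0 ?ltW.
  by move=> zu; have := mmin m; rewrite ltnn => /(_ (introT (asboolP _) zu)).
rewrite -[X in X ^- m](lnK (x := G)) ?posrE// -expRM_natl -expRN -expRD ler_expR.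
have am : a * m%:R ^+ 2 <= alpha / 2 * sqdist z u.
  apply: le_trans (_ : alpha / 2 * (m%:R * r / 2) ^+ 2 <= _).
    by rewrite /a le_eqVlt; apply/orP; left; apply/eqP; field.
  by rewrite ler_pM2l// divr_gt0.
apply: le_trans (_ : - (a * m%:R ^+ 2) <= _); first by rewrite lerN2.
rewrite -subr_ge0 (_ : _ - _ = (ln G - 2 * a * m%:R) ^+ 2 / (4 * a)).
  by rewrite divr_ge0 ?sqr_ge0// mulr_ge0// ltW.
by field; rewrite gt_eqF.
Qed.

Local Open Scope ereal_scope.

(** Slicing the kernel along the cubes [cube z ((m + 1) r)] and using
[kern_decay] for the ratio [2 G] leaves a geometric series of ratio 1/2. *)
Lemma kern_integral_le (G : R) : (0 < G)%R -> exists2 M : R, (0 < M)%R &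
  forall (H : Cn -> \bar R) z (B : R), measurable_fun setT H ->
  (forall u, 0 <= H u) -> (0 <= B)%R ->
  (forall m, \int[vol R n]_(u in cube z (m.+1%:R * r)) H u <= (B * G ^+ m)%:E) ->
  \int[vol R n]_u ((kern z u)%:E * H u) <= (M * B)%:E.
Proof.
move=> G0; have [M M0 decay] := kern_decay (mulr_gt0 (ltr0n R 2) G0).
exists (2 * M)%R; first by rewrite mulr_gt0.
move=> H z B mH H0 B0 HB.
pose F m u := (M * (2 * G) ^- m)%:E * (H u * (\1_(cube z (m.+1%:R * r)) u)%:E).
have c0 m : (0 <= M * (2 * G) ^- m)%R.
  by rewrite mulr_ge0 ?invr_ge0 ?exprn_ge0 ?mulr_ge0 // ltW.
have F0 m u : 0 <= F m u by rewrite !mule_ge0 ?lee_fin.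
have mH1 m : measurable_fun setT (fun u => H u * (\1_(cube z (m.+1%:R * r)) u)%:E).
  apply: emeasurable_funM => //.
  by apply: (measurable_indic_comp (f := id)); first exact: measurable_cube.
have mF m : measurable_fun setT (F m) by apply: emeasurable_funM.
apply: (@le_trans _ _ (\int[vol R n]_u \sum_(m <oo) F m u)).
  apply: le_lower_integral => [u _|u _].
    by rewrite mule_ge0// lee_fin ltW// kern_gt0.
  have [m zu km] := decay z u.
  apply: (@le_trans _ _ (F m u)).
    rewrite /F indicE mem_set// mule1; apply: lee_pmul; rewrite ?lee_fin//.
    by rewrite ltW// kern_gt0.
  rewrite (@nneseriesD1 _ (F ^~ u) m xpredT)// leeDl//.
  exact: nneseries_ge0.
rewrite integral_nneseries//.
apply: le_trans (_ : \sum_(m <oo) ((2 * M * B) / (2 ^ m.+1)%:R)%:E <= _); last first.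
  by apply: epsilon_trick0; rewrite !mulr_ge0// ltW.
apply: lee_nneseries => [m _ _|m _]; first exact: integral_ge0.
rewrite /F ge0_integralZl//; last 2 first.
- by move=> u _; rewrite mule_ge0 ?lee_fin.
- by rewrite lee_fin.
rewrite (integral_indicr _ (cube _ _)).
apply: le_trans (lee_wpmul2l _ (HB m)) _; first by rewrite lee_fin.
rewrite -EFinM lee_fin le_eqVlt; apply/orP; left; apply/eqP.
have Gm : (G ^+ m != 0)%R by rewrite expf_neq0 ?gt_eqF.
by rewrite exprMn natrX exprS; field; rewrite Gm expf_neq0.
Qed.

End gaussian_kernel.

Section growth.
Variables (R : realType) (n : nat) (r : R).
Hypothesis r_gt0 : 0 < r.
Local Notation Cn := (Cspace R n).

Lemma cube_interpolation (z x : Cn) (a b : R) : 0 <= a -> 0 < b ->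
  cube z (a + b) x -> exists2 y, cube z a y & cube y b x.
Proof.
move=> a0 b0 zx; pose c := a / (a + b).
have ab0 : 0 < a + b by rewrite ltr_wpDl.
have c0 : 0 <= c by rewrite divr_ge0 // ltW.
have c1 : 0 <= 1 - c by rewrite subr_ge0 ler_pdivrMr// mul1r lerDl ltW.
have ca : c * ((a + b) / 2) = a / 2 by rewrite /c; field; rewrite gt_eqF.
have cb : (1 - c) * ((a + b) / 2) = b / 2 by rewrite /c; field; rewrite gt_eqF.
clearbody c; pose y : Cn := [tuple
  (complex.Re (tnth z j) + c * (complex.Re (tnth x j) - complex.Re (tnth z j))) +i*
  (complex.Im (tnth z j) + c * (complex.Im (tnth x j) - complex.Im (tnth z j)))
  | j < n].
exists y => j; have [zr zi] := zx j; rewrite tnth_mktuple /=.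
- have e (s t : R) : t + c * (s - t) - t = c * (s - t) by ring.
  by rewrite !e !normrM (ger0_norm c0) -ca; split; exact: ler_wpM2l.
- have e (s t : R) : s - (t + c * (s - t)) = (1 - c) * (s - t) by ring.
  by rewrite !e !normrM (ger0_norm c1) -cb; split; exact: ler_wpM2l.
Qed.

Local Open Scope ereal_scope.

(** From one scale to all scales: cubes of side [r] whose integrals grow
geometrically with the distance control all cubes centred at [z]. The factor
[((m + 2)^2)^n] given by averaging is absorbed by [m + 2 <= 2^(m + 1)]. *)
Lemma cube_growth (H : Cn -> \bar R) z (B C : R) :
  measurable_fun setT H -> (forall u, 0 <= H u) -> (0 <= B)%R -> (0 <= C)%R ->
  (forall m x, cube z (m.+2%:R * r) x ->
     \int[vol R n]_(u in cube x r) H u <= (B * C ^+ m)%:E) ->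
  forall m, \int[vol R n]_(u in cube z (m.+1%:R * r)) H u <=
    ((4 ^+ n * B) * (4 ^+ n * C) ^+ m)%:E.
Proof.
move=> mH H0 B0 C0 HB m.
have mr0 : (0 <= m.+1%:R * r)%R by rewrite mulr_ge0// ltW.
have BC0 : 0 <= (B * C ^+ m)%:E by rewrite lee_fin mulr_ge0// exprn_ge0.
have mE : (m.+1%:R * r + r = m.+2%:R * r)%R by rewrite -[in RHS]natr1 mulrDl mul1r.
have := cube_averaging (z := z) mr0 (ltW r_gt0) mH H0 BC0.
rewrite mE => /(_ (HB m)).
have rn0 : (0 < r ^+ 2 ^+ n)%R by rewrite !exprn_gt0.
rewrite muleC -lee_pdivlMr// => /le_trans; apply.
rewrite -EFinM lee_fin.
have -> : (((m.+2%:R * r) ^+ 2) ^+ n * (B * C ^+ m) / r ^+ 2 ^+ n =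
  (m.+2%:R ^+ 2) ^+ n * (B * C ^+ m))%R.
  by rewrite (exprMn 2) (exprMn n) [X in (X / _)%R]mulrAC mulfK// gt_eqF.
have -> : (4 ^+ n * B * (4 ^+ n * C) ^+ m = (4 ^+ m.+1) ^+ n * (B * C ^+ m))%R.
  by rewrite exprMn exprS exprMn exprAC; ring.
rewrite ler_wpM2r ?mulr_ge0 ?exprn_ge0// lerXn2r ?nnegrE ?exprn_ge0//.
have -> : (4 = 2 ^+ 2 :> R)%R by rewrite expr2 -natrM.
rewrite exprAC lerXn2r ?nnegrE ?exprn_ge0// -natrX ler_nat.
by rewrite ltn_expl.
Qed.

(** The form in which the Gaussian kernel is used from here on: local bounds at
scale [r], with at most geometric growth, bound its integrals uniformly. With
[C = 1] it handles functions of bounded averages, and for [C] a power of the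
doubling constant it handles the weight. *)
Lemma kern_growth (alpha C : R) : (0 < alpha)%R -> (0 < C)%R ->
  exists2 M : R, (0 < M)%R &
  forall (H : Cn -> \bar R) z (B : R), measurable_fun setT H ->
  (forall u, 0 <= H u) -> (0 <= B)%R ->
  (forall m x, cube z (m.+2%:R * r) x ->
     \int[vol R n]_(u in cube x r) H u <= (B * C ^+ m)%:E) ->
  \int[vol R n]_u ((kern alpha z u)%:E * H u) <= (M * B)%:E.
Proof.
move=> a0 C0; have G0 : (0 < 4 ^+ n * C)%R by rewrite mulr_gt0// exprn_gt0.
have [M M0 HM] := kern_integral_le n a0 r_gt0 G0.
exists (M * 4 ^+ n)%R; first by rewrite mulr_gt0// exprn_gt0.
move=> H z B mH H0 B0 HB; rewrite -mulrA; apply: HM => //.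
  by rewrite mulr_ge0// exprn_ge0.
exact: cube_growth (ltW C0) HB.
Qed.

End growth.

(** * Doubling weights *)

Section doubling_weight.
Variables (R : realType) (n : nat) (alpha r C : R).
Hypotheses (alpha_gt0 : 0 < alpha) (r_gt0 : 0 < r) (C_ge1 : 1 <= C).
Local Notation Cn := (Cspace R n).
Variable w : Cn -> R.
Hypotheses (mw : measurable_fun setT w) (w_ge0 : forall z, 0 <= w z).
Local Notation W z := (\int[vol R n]_(u in cube z r) (w u)%:E)%E.
Hypothesis W_fin : forall z, (W z < +oo)%E.
Hypothesis w_doubling : forall z,
  (\int[vol R n]_(u in cube z (2 * r)) (w u)%:E <= C%:E * W z)%E.

Definition cube_mass (z : Cn) : R := fine (W z).

Lemma doubling_cst_gt0 : 0 < C. Proof. exact: lt_le_trans C_ge1. Qed.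

Lemma cube_massE z : W z = (cube_mass z)%:E.
Proof.
rewrite /cube_mass fineK// ge0_fin_numE// integral_ge0// => u _.
by rewrite lee_fin.
Qed.

Lemma cube_mass_ge0 z : 0 <= cube_mass z.
Proof. by rewrite fine_ge0// integral_ge0// => u _; rewrite lee_fin. Qed.

(** [cube x r] is contained in [cube z (2 r)]. *)
Lemma cube_mass_near z x : cube z r x -> cube_mass x <= C * cube_mass z.
Proof.
move=> zx; rewrite -lee_fin EFinM -!cube_massE.
apply: le_trans (w_doubling z).
apply: ge0_subset_integral.
- exact: measurable_cube.
- exact: measurable_cube.
- by apply/measurable_EFinP; exact: measurable_funTS.
- by move=> u _; rewrite lee_fin.
- by move=> u xu; rewrite mulr_natl mulr2n; exact: cube_trans zx xu.
Qed.

(** The mass is multiplied by at most [C] at each step of length [r / 2] in the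
sup-norm, along the segment from [z] to [x]. *)
Lemma cube_mass_chain m z x : cube z (m.+1%:R * r) x ->
  cube_mass x <= C ^+ m.+1 * cube_mass z.
Proof.
elim: m x => [|m IH] x; first by rewrite mul1r expr1; exact: cube_mass_near.
rewrite -natr1 mulrDl mul1r => /cube_interpolation[||y zy yx]//.
  by rewrite mulr_ge0// ltW.
apply: le_trans (cube_mass_near yx) _.
by rewrite exprS -mulrA ler_wpM2l ?(ltW doubling_cst_gt0)// IH.
Qed.

Lemma kern_weight_le : exists2 M : R, 0 < M &
  forall z, (\int[vol R n]_u ((kern alpha z u)%:E * (w u)%:E) <= (M * cube_mass z)%:E)%E.
Proof.
have [M M0 HM] := kern_growth n r_gt0 alpha_gt0 doubling_cst_gt0.
exists (M * C ^+ 2); first by rewrite mulr_gt0// exprn_gt0// doubling_cst_gt0.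
move=> z; rewrite -mulrA; apply: HM.
- exact/measurable_EFinP.
- by move=> u; rewrite lee_fin.
- by rewrite mulr_ge0 ?cube_mass_ge0// exprn_ge0// ltW// doubling_cst_gt0.
move=> m x zx; rewrite cube_massE lee_fin (le_trans (cube_mass_chain zx))//.
by rewrite [leRHS]mulrAC -exprD.
Qed.

(** By [kern_weight_le] the integral of the weight against the everywhere positive
Gaussian centred at [z0] is 0. *)
Lemma weight_ae0 z0 : cube_mass z0 = 0 -> {ae vol R n, forall z, w z = 0}.
Proof.
move=> W0; have [M _ /(_ z0)] := kern_weight_le; rewrite W0 mulr0 => kw.
have mkw : measurable_fun setT (fun u => (kern alpha z0 u * w u)%:E).
  apply/measurable_EFinP; apply: measurable_funM => //.
  exact: (measurable_kern alpha (f := fun=> z0) (g := id)).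
have : (\int[vol R n]_u `|(kern alpha z0 u * w u)%:E| = 0)%E.
  apply/eqP; rewrite eq_le integral_ge0// andbT; apply: le_trans kw.
  apply: le_lower_integral => // u _.
  by rewrite gee0_abs ?EFinM// lee_fin mulr_ge0// ltW// kern_gt0.
move=> /(ae_eq_integral_abs _ measurableT mkw); apply: filterS => u /(_ I) /= [].
by move=> /eqP; rewrite mulf_eq0 gt_eqF ?kern_gt0//= => /eqP.
Qed.

Lemma measurable_cube_mass : measurable_fun setT cube_mass.
Proof.
pose E := [set xu : Cn * Cn | cube xu.1 r xu.2].
have mE : measurable E by apply: (@measurable_cube_rel _ _ _ _ fst snd).
apply/measurable_EFinP.
have -> : EFin \o cube_mass = fun z => (\int[vol R n]_u ((w u)%:E * (\1_E (z, u))%:E))%E.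
  apply/funext => z /=; rewrite -cube_massE -(integral_indicr _ (cube z r)).
  by apply: eq_integral => u _; congr (_ * _)%E.
apply: (measurable_fun_fubini_tonelli_F
  (fun zu : Cn * Cn => (w zu.2)%:E * (\1_E zu)%:E)%E).
- apply: emeasurable_funM; last exact: (measurable_indic_comp (f := id)).
  by apply/measurable_EFinP; exact: measurableT_comp.
- by move=> zu; rewrite mule_ge0 ?lee_fin.
Qed.

Hypothesis cube_mass_gt0 : forall z, 0 < cube_mass z.

(** One half of a Schur test: by Tonelli and the symmetry of the kernel, the
weight is first integrated against the kernel, which gives back a multiple of
[cube_mass u] and cancels the denominator. *)
Lemma kern_schur : exists2 M : R, 0 < M &
  forall F : Cn -> \bar R, measurable_fun setT F -> (forall u, 0 <= F u)%E ->
  (\int[vol R n]_z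
     ((\int[vol R n]_u ((kern alpha z u / cube_mass u)%:E * F u)) * (w z)%:E) <=
   M%:E * \int[vol R n]_u F u)%E.
Proof.
have [M M0 HM] := kern_weight_le; exists M => // F mF F0.
pose k (zu : Cn * Cn) : R := kern alpha zu.1 zu.2 / cube_mass zu.2.
have k0 zu : 0 <= k zu by rewrite divr_ge0// ltW// kern_gt0.
have mk : measurable_fun setT k.
  apply: measurable_funM; first exact: measurable_kern.
  apply: measurable_inv_ge0 => [|zu]; last exact: ltW.
  by apply: measurableT_comp => //; exact: measurable_cube_mass.
pose K (zu : Cn * Cn) := ((k zu)%:E * F zu.2 * (w zu.1)%:E)%E.
have K0 zu : (0 <= K zu)%E by rewrite !mule_ge0 ?lee_fin.
have mK : measurable_fun setT K.
  apply: emeasurable_funM; last first.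
    by apply/measurable_EFinP; exact: measurableT_comp.
  by apply: emeasurable_funM; [exact/measurable_EFinP|exact: measurableT_comp].
have mkz z : measurable_fun setT (fun u => k (z, u)) by exact: measurableT_comp.
have mku u : measurable_fun setT (fun z => k (z, u)) by exact: measurableT_comp.
apply: (@le_trans _ _ (\int[vol R n]_z \int[vol R n]_u K (z, u))%E).
  rewrite le_eqVlt; apply/orP; left; apply/eqP.
  apply: eq_integral => z _; rewrite -ge0_integralZr//.
  - by apply: emeasurable_funM => //; apply/measurable_EFinP; exact: mkz.
  - by move=> u _; rewrite mule_ge0 ?lee_fin ?(k0 (z, u)).
  - by rewrite lee_fin.
rewrite (fubini_tonelli K)// -ge0_integralZl//; last by rewrite lee_fin ltW.
apply: le_lower_integral => [u _|u _]; first exact: integral_ge0.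
have -> : (\int[vol R n]_z K (z, u) = (F u * (cube_mass u)^-1%:E) *
    \int[vol R n]_z ((kern alpha u z)%:E * (w z)%:E))%E.
  rewrite -ge0_integralZl//.
  - apply: eq_integral => z _; rewrite /K /k /= (kern_sym _ u z).
    rewrite EFinM [RHS]muleA; congr (_ * _)%E.
    by rewrite muleC [X in (_ * X)%E]muleC muleA.
  - apply: emeasurable_funM; last exact/measurable_EFinP.
    apply/measurable_EFinP.
    exact: (measurable_kern alpha (f := fun=> u) (g := id)).
  - by move=> z _; rewrite mule_ge0 ?lee_fin// ltW// kern_gt0.
  - by rewrite mule_ge0// lee_fin invr_ge0 ltW.
apply: le_trans (lee_wpmul2l _ (HM u)) _.
  by rewrite mule_ge0// lee_fin invr_ge0 ltW.
rewrite -muleA -EFinM muleC lee_wpmul2r// lee_fin.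
by rewrite mulrCA mulVf ?mulr1// gt_eqF.
Qed.

End doubling_weight.

(** * Sufficiency for the Gaussian kernel *)

Section kernel_operator.
Variables (R : realType) (n : nat) (alpha r C : R).
Hypotheses (alpha_gt0 : 0 < alpha) (r_gt0 : 0 < r) (C_ge1 : 1 <= C).
Local Notation Cn := (Cspace R n).

Lemma le_poweR (x y : \bar R) (s : R) : 0 <= s -> (0 <= x)%E -> (x <= y)%E ->
  (x `^ s <= y `^ s)%E.
Proof.
move=> s0 x0 xy; apply: gt0_ler_poweR (xy) => //; rewrite in_itv/= ?leey andbT//.
exact: le_trans xy.
Qed.

Lemma conjugate_gt0 (p p' : R) : 1 < p -> p^-1 + p'^-1 = 1 -> 0 < p'.
Proof.
move=> p1 pq; have p0 : 0 < p by apply: lt_trans p1.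
have e : p'^-1 = 1 - p^-1 by rewrite -pq addrC addKr.
by rewrite -invr_gt0 e subr_gt0 invf_lt1.
Qed.

Lemma hoelder_pow d (T : measurableType d) (mu : {measure set T -> \bar R})
    (f g : T -> R) (p q : R) :
  measurable_fun setT f -> measurable_fun setT g ->
  (forall x, 0 <= f x) -> (forall x, 0 <= g x) ->
  0 < p -> 0 < q -> p^-1 + q^-1 = 1 ->
  ((\int[mu]_x (f x * g x)%:E) `^ p <=
   (\int[mu]_x (f x `^ p)%:E) * (\int[mu]_x (g x `^ q)%:E) `^ (p / q))%E.
Proof.
move=> mf mg f0 g0 p0 q0 pq.
have := hoelder mu mf mg p0 q0 pq.
have -> : 'N[mu]_1[EFin \o (f \* g)%R]%E = (\int[mu]_x (f x * g x)%:E)%E.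
  by rewrite Lnorm1; apply: eq_integral => x _; rewrite /= ger0_norm// mulr_ge0.
have pn0 : p != 0 by rewrite gt_eqF.
have qn0 : q != 0 by rewrite gt_eqF.
have e (s : R) (k : T -> R) : s != 0 -> (forall x, 0 <= k x) ->
    ('N[mu]_s%:E[EFin \o k] `^ s = \int[mu]_x (k x `^ s)%:E)%E.
  move=> s0 k0; rewrite poweR_Lnorm//; apply: eq_integral => x _.
  by rewrite /= ger0_norm// poweR_EFin.
rewrite -(e p f)// -(e q g)// -poweRrM [q * _]mulrC mulfVK// -poweRM ?Lnorm_ge0//.
move=> H; apply: le_poweR H; first exact: ltW.
by apply: integral_ge0 => x _; rewrite lee_fin mulr_ge0.
Qed.

Variables (w h : Cn -> R).
Hypotheses (mw : measurable_fun setT w) (w_ge0 : forall z, 0 <= w z).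
Hypotheses (mh : measurable_fun setT h) (h_ge0 : forall z, 0 <= h z).
Local Notation W z := (\int[vol R n]_(u in cube z r) (w u)%:E)%E.
Hypothesis W_fin : forall z, (W z < +oo)%E.
Hypothesis w_doubling : forall z,
  (\int[vol R n]_(u in cube z (2 * r)) (w u)%:E <= C%:E * W z)%E.
Local Notation cube_mass := (cube_mass r w).
Hypothesis cube_mass_gt0 : forall z, 0 < cube_mass z.

(** The positive operator that dominates the Toeplitz operator after the Gaussian
factors have been moved into the functions; [h] stands for the modulus of the
symbol. *)
Definition kop (g : Cn -> R) z := (\int[vol R n]_u (kern alpha z u * (h u * g u))%:E)%E.

Definition kop_bounded (p : R) := exists2 M : R, 0 <= M &
  forall g : Cn -> R, measurable_fun setT g -> (forall u, 0 <= g u) ->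
  (\int[vol R n]_z (kop g z `^ p * (w z)%:E) <=
   M%:E * \int[vol R n]_u (g u `^ p * w u)%:E)%E.

Lemma measurable_kern_center z : measurable_fun setT (kern alpha z : Cn -> R).
Proof. exact: (measurable_kern alpha (f := fun=> z) (g := id)). Qed.

Lemma kop_bounded_of_pointwise (p M0 : R) : 0 <= M0 ->
  (forall (g : Cn -> R) z, measurable_fun setT g -> (forall u, 0 <= g u)%R ->
   kop g z `^ p <= M0%:E *
     \int[vol R n]_u ((kern alpha z u / cube_mass u)%:E * (g u `^ p * w u)%:E))%E ->
  kop_bounded p.
Proof.
move=> M00 key.
have [M M_gt0 HM] := kern_schur alpha_gt0 r_gt0 C_ge1 mw w_ge0 W_fin w_doubling cube_mass_gt0.
exists (M0 * M) => [|g mg g0]; first by rewrite mulr_ge0// ltW.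
pose F u := (g u `^ p * w u)%:E.
have mF : measurable_fun setT F.
  apply/measurable_EFinP; apply: measurable_funM => //.
  exact: (measurableT_comp (measurable_powR p)).
have F0 u : (0 <= F u)%E by rewrite lee_fin mulr_ge0// powR_ge0.
have k0 z u : 0 <= kern alpha z u / cube_mass u by rewrite divr_ge0// ltW// kern_gt0.
apply: (@le_trans _ _ (M0%:E * \int[vol R n]_z
    ((\int[vol R n]_u ((kern alpha z u / cube_mass u)%:E * F u)) * (w z)%:E))%E); last first.
  by rewrite EFinM -muleA lee_wpmul2l ?lee_fin// HM.
rewrite -ge0_integralZl//.
- apply: le_lower_integral => [z _|z _]; first by rewrite mule_ge0 ?poweR_ge0 ?lee_fin.
  by rewrite muleA lee_wpmul2r ?lee_fin// key.
- apply: emeasurable_funM; last exact/measurable_EFinP.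
  apply: (measurable_fun_fubini_tonelli_F
    (fun zu : Cn * Cn => (kern alpha zu.1 zu.2 / cube_mass zu.2)%:E * F zu.2)%E).
  + apply: emeasurable_funM; last exact: measurableT_comp.
    apply/measurable_EFinP; apply: measurable_funM; first exact: measurable_kern.
    apply: measurable_inv_ge0 => [|zu]; last exact: ltW.
    by apply: measurableT_comp => //; exact: measurable_cube_mass.
  + by move=> zu; rewrite mule_ge0// lee_fin k0.
- move=> z _; rewrite mule_ge0 ?lee_fin// integral_ge0// => u _.
  by rewrite mule_ge0// lee_fin k0.
Qed.

(** Replacing [h u] by [B w(u) / cube_mass u] gives the pointwise bound directly. *)
Lemma kop_bounded_eq1 (B : R) : 0 <= B ->
  {ae vol R n, forall u, h u * cube_mass u <= B * w u} -> kop_bounded 1.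
Proof.
move=> B0 hw; apply: (kop_bounded_of_pointwise B0) => g z mg g0.
rewrite poweRe1; last first.
  by apply: integral_ge0 => u _; rewrite lee_fin !mulr_ge0// ltW// kern_gt0.
have k0 u : 0 <= kern alpha z u / cube_mass u by rewrite divr_ge0// ltW// kern_gt0.
have kw0 u : (0 <= (kern alpha z u / cube_mass u)%:E * (g u `^ 1 * w u)%:E)%E.
  by rewrite -EFinM lee_fin mulr_ge0// mulr_ge0// powR_ge0.
rewrite -ge0_integralZl//.
- apply: ae_le_lower_integral.
  + by move=> u _; rewrite lee_fin !mulr_ge0// ltW// kern_gt0.
  + by move=> u _; rewrite mule_ge0.
  apply: filterS hw => u hw _; rewrite -!EFinM lee_fin powRr1//.
  have c0 := cube_mass_gt0 u.
  rewrite (_ : B * _ = kern alpha z u * g u * (B * w u / cube_mass u)); last by ring.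
  rewrite (_ : kern _ _ _ * (h u * _) = kern alpha z u * g u * h u); last by ring.
  rewrite ler_wpM2l//.
    by rewrite mulr_ge0// ltW// kern_gt0.
  by rewrite ler_pdivlMr.
- rewrite -[X in measurable_fun _ X]/(fun u => ((kern alpha z u / cube_mass u) * (g u `^ 1 * w u))%:E).
  apply/measurable_EFinP; apply: measurable_funM.
    apply: measurable_funM; first exact: measurable_kern_center.
    apply: measurable_inv_ge0 => [|u]; last exact: ltW.
    exact: measurable_cube_mass.
  apply: measurable_funM => //.
  exact: (measurableT_comp (measurable_powR _)).
Qed.

(** Hoelder's inequality for the measure [kern alpha z u du] and the
factorization of [h g] into [g (w / cube_mass)^(1/p)] and [h (cube_mass / w)^(1/p)]. The
second factor to the power [p'] is [h^p' w^(-p'/p) cube_mass^(p'/p)], whose integrals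
over cubes of side [r] are bounded, since [cube_mass] is constant on such a
cube up to a factor [C]; [kern_growth] with ratio 1 then bounds it uniformly in [z]. *)
Lemma kop_bounded_gt1 (p p' B : R) : 1 < p -> p^-1 + p'^-1 = 1 -> 0 <= B ->
  {ae vol R n, forall u, w u = 0 -> h u = 0} ->
  (forall x, \int[vol R n]_(u in cube x r) (h u `^ p' * (w u)^-1 `^ (p' / p))%:E <=
     (B / cube_mass x `^ (p' / p))%:E)%E ->
  kop_bounded p.
Proof.
move=> p1 pq B0 hw0 HB.
have p0 : 0 < p by apply: lt_trans p1.
have p'0 : 0 < p' := conjugate_gt0 p1 pq.
pose s := p' / p; have s0 : 0 < s by rewrite divr_gt0.
have [M M0 HM] := kern_growth n r_gt0 alpha_gt0 (@ltr01 R).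
pose H2 u := h u `^ p' * (w u)^-1 `^ s * cube_mass u `^ s.
have H20 u : 0 <= H2 u by rewrite !mulr_ge0// powR_ge0.
have mwi : measurable_fun setT (fun u => (w u)^-1) by exact: measurable_inv_ge0.
have mc : measurable_fun setT cube_mass by exact: measurable_cube_mass.
have mci : measurable_fun setT (fun u => (cube_mass u)^-1).
  by apply: measurable_inv_ge0 => // u; exact: ltW.
have mH1 : measurable_fun setT (fun u => h u `^ p' * (w u)^-1 `^ s).
  apply: measurable_funM.
    exact: (measurableT_comp (measurable_powR _)).
  exact: (measurableT_comp (measurable_powR _)).
have mH2 : measurable_fun setT H2.
  apply: measurable_funM => //.
  exact: (measurableT_comp (measurable_powR _)).
have K0 : 0 <= B * C `^ s by rewrite mulr_ge0// powR_ge0.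
have kH2 z : (\int[vol R n]_u (kern alpha z u * H2 u)%:E <= (M * (B * C `^ s))%:E)%E.
  under eq_integral do rewrite EFinM.
  apply: HM => //; first exact/measurable_EFinP.
  move=> m x _; rewrite expr1n mulr1.
  have Hx : (\int[vol R n]_(u in cube x r) (H2 u)%:E <=
     ((C * cube_mass x) `^ s)%:E *
     \int[vol R n]_(u in cube x r) (h u `^ p' * (w u)^-1 `^ s)%:E)%E.
    rewrite -ge0_integralZl//; last 4 first.
    - exact: measurable_cube.
    - by apply/measurable_EFinP; exact: measurable_funTS.
    - by move=> u _; rewrite lee_fin mulr_ge0// powR_ge0.
    - by rewrite lee_fin powR_ge0.
    apply: le_lower_integral => u xu; first by rewrite lee_fin.
    rewrite -EFinM lee_fin mulrC /H2 ler_wpM2l ?mulr_ge0 ?powR_ge0//.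
    apply: ge0_ler_powR (cube_mass_near mw w_ge0 W_fin w_doubling xu).
    - exact: ltW.
    - by rewrite nnegrE ltW.
    - by rewrite nnegrE mulr_ge0// ltW// (lt_le_trans _ C_ge1).
  apply: (le_trans Hx); apply: le_trans (lee_wpmul2l _ (HB x)) _.
    by rewrite lee_fin powR_ge0.
  rewrite -EFinM lee_fin powRM ?(ltW (cube_mass_gt0 _))//; last first.
    by rewrite ltW// (lt_le_trans _ C_ge1).
  rewrite -/s mulrACA divff ?mulr1; last by rewrite gt_eqF// powR_gt0.
  by rewrite mulrC.
apply: (@kop_bounded_of_pointwise p ((M * (B * C `^ s)) `^ (p / p'))).
  exact: powR_ge0.
move=> g z mg g0.
(* the two factors; where [w] vanishes both products are 0, by [hw0] *)
pose F u := (kern alpha z u / cube_mass u * w u) `^ p^-1 * g u.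
pose G u := kern alpha z u `^ p'^-1 * h u * (cube_mass u * (w u)^-1) `^ p^-1.
have k0 u : 0 <= kern alpha z u by rewrite ltW// kern_gt0.
have c0 u : 0 <= cube_mass u by exact: ltW.
have F0 u : 0 <= F u by rewrite mulr_ge0// powR_ge0.
have G0 u : 0 <= G u by rewrite !mulr_ge0// powR_ge0.
have mF : measurable_fun setT F.
  apply: measurable_funM => //; apply: (measurableT_comp (measurable_powR _)).
  apply: measurable_funM => //; apply: measurable_funM => //.
  exact: measurable_kern_center.
have mG : measurable_fun setT G.
  apply: measurable_funM.
    apply: measurable_funM => //; apply: (measurableT_comp (measurable_powR _)).
    exact: measurable_kern_center.
  by apply: (measurableT_comp (measurable_powR _)); exact: measurable_funM.
have -> : kop g z = (\int[vol R n]_u (F u * G u)%:E)%E.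
  apply: ae_eq_lower_integral => [u _|u _|].
  - by rewrite lee_fin !mulr_ge0.
  - by rewrite lee_fin mulr_ge0.
  apply: filterS hw0 => u hw0 _; congr EFin; rewrite /F /G.
  have [wu0|wu0] := eqVneq (w u) 0; first by rewrite hw0// mul0r mulr0 !(mulr0, mul0r).
  rewrite [RHS](_ : _ = (kern alpha z u / cube_mass u * w u) `^ p^-1 *
     (cube_mass u * (w u)^-1) `^ p^-1 * kern alpha z u `^ p'^-1 * (h u * g u)); last by ring.
  congr (_ * _); rewrite -powRM ?mulr_ge0 ?invr_ge0//.
  rewrite (_ : _ * _ * (cube_mass u / _) = kern alpha z u); last first.
    by field; rewrite wu0 gt_eqF.
  rewrite -powRD ?pq ?powRr1//.
  by apply/implyP => _; rewrite gt_eqF// kern_gt0.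
apply: le_trans (hoelder_pow (vol R n) mF mG F0 G0 p0 p'0 pq) _.
have -> : (\int[vol R n]_u (F u `^ p)%:E =
   \int[vol R n]_u ((kern alpha z u / cube_mass u)%:E * (g u `^ p * w u)%:E))%E.
  apply: eq_integral => u _; rewrite -EFinM; congr EFin.
  rewrite /F powRM ?powR_ge0// -powRrM mulVf ?gt_eqF// powRr1.
    by ring.
  by rewrite mulr_ge0// divr_ge0.
have -> : (\int[vol R n]_u (G u `^ p')%:E =
   \int[vol R n]_u (kern alpha z u * H2 u)%:E)%E.
  apply: eq_integral => u _; congr EFin; rewrite /G /H2.
  rewrite powRM ?mulr_ge0 ?powR_ge0// powRM ?powR_ge0// -!powRrM.
  rewrite mulVf ?gt_eqF// powRr1// [p^-1 * _]mulrC -/s powRM ?invr_ge0//.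
  by ring.
rewrite muleC lee_wpmul2r//.
  apply: integral_ge0 => u _; rewrite -EFinM lee_fin !mulr_ge0 ?powR_ge0//.
  by rewrite invr_ge0.
rewrite -poweR_EFin; apply: le_poweR => //.
- by rewrite divr_ge0// ltW.
- by rewrite integral_ge0// => u _; rewrite lee_fin mulr_ge0.
Qed.

End kernel_operator.

(** * From the Gaussian kernel to the Toeplitz operator *)

Section toeplitz_upper.
Variables (R : realType) (n : nat) (alpha : R).
Hypothesis alpha_gt0 : 0 < alpha.
Local Notation Cn := (Cspace R n).

Lemma Re_sum (F : 'I_n -> R[i]) :
  complex.Re (\sum_(j < n) F j) = \sum_(j < n) complex.Re (F j).
Proof. by apply: (big_morph (@complex.Re R)) => // -[? ?] [? ?]. Qed.

Lemma Im_sum (F : 'I_n -> R[i]) :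
  complex.Im (\sum_(j < n) F j) = \sum_(j < n) complex.Im (F j).
Proof. by apply: (big_morph (@complex.Im R)) => // -[? ?] [? ?]. Qed.

Lemma Re_hdot (z u : Cn) : complex.Re (hdot z u) =
  \sum_(j < n) (complex.Re (tnth z j) * complex.Re (tnth u j) +
                complex.Im (tnth z j) * complex.Im (tnth u j)).
Proof.
rewrite /hdot Re_sum; apply: eq_bigr => j _.
by case: (tnth z j) => a b; case: (tnth u j) => c e /=; rewrite mulrN opprK.
Qed.

Lemma sqnormE (z : Cn) : sqnorm z =
  \sum_(j < n) (complex.Re (tnth z j) ^+ 2 + complex.Im (tnth z j) ^+ 2).
Proof.
by apply: eq_bigr => j _; rewrite normcE sqr_sqrtr// addr_ge0 ?sqr_ge0.
Qed.

Lemma sqdist_hdot (z u : Cn) :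
  sqdist z u = sqnorm z + sqnorm u - 2 * complex.Re (hdot z u).
Proof.
rewrite !sqnormE Re_hdot mulr_sumr -sumrN -!big_split /=.
by apply: eq_bigr => j _; ring.
Qed.

Lemma measurable_sqnorm : measurable_fun setT (@sqnorm R n).
Proof.
rewrite (funext sqnormE).
apply: measurable_sum => j; apply: measurable_funD; apply: measurable_funX.
- exact: (@measurable_Re_tnth R _ _ n j id).
- exact: (@measurable_Im_tnth R _ _ n j id).
Qed.

Lemma normc_cexp (z : R[i]) : Normc.normc (cexp z) = expR (complex.Re z).
Proof.
rewrite /cexp Normc.normcM !normcE /= expr0n/= addr0 cos2Dsin2 sqrtr1 mulr1.
by rewrite sqrtr_sqr ger0_norm// expR_ge0.
Qed.

Lemma normc_real (x : R) : 0 <= x -> Normc.normc x%:C%C = x.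
Proof. by move=> x0; rewrite normcE /= expr0n/= addr0 sqrtr_sqr ger0_norm. Qed.

Lemma Re_scale (a : R) (z : R[i]) : complex.Re (a%:C * z) = a * complex.Re z.
Proof. by case: z => x y /=; rewrite mul0r subr0. Qed.

Lemma Im_scale (a : R) (z : R[i]) : complex.Im (a%:C * z) = a * complex.Im z.
Proof. by case: z => x y /=; rewrite mul0r addr0. Qed.

(** The function whose [L^p] norm with respect to [w dv] is the Fock norm of
[f]. *)
Definition fock_density (f : Cn -> R[i]) (u : Cn) : R :=
  Normc.normc (f u) * expR (- (alpha / 2 * sqnorm u)).

Lemma fock_density_ge0 f u : 0 <= fock_density f u.
Proof. by rewrite mulr_ge0 ?normc_ge0 ?expR_ge0. Qed.

Lemma measurable_fock_density f : measurable_fun setT f ->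
  measurable_fun setT (fock_density f).
Proof.
move=> mf; apply: measurable_funM; first exact: measurable_normc_comp.
apply: (measurableT_comp (@measurable_expR _)).
apply: measurableT_comp => //; apply: measurable_funM => //.
exact: measurable_sqnorm.
Qed.

Lemma fock_intE (p : R) (w : Cn -> R) (f : Cn -> R[i]) :
  fock_int alpha p w f = (\int[vol R n]_u (fock_density f u `^ p * w u)%:E)%E.
Proof.
apply: eq_integral => u _; congr (_ * _)%:E.
rewrite /fock_density powRM ?normc_ge0 ?expR_ge0// -expRM; congr (_ * expR _).
by ring.
Qed.

(** The polarization identity [|z - u|^2 = |z|^2 + |u|^2 - 2 Re <z, u>]: the
reproducing kernel and the Gaussian weights combine into a function of
[z - u]. *)
Lemma gaussian_exponent (z u : Cn) :
  alpha * complex.Re (hdot z u) - alpha * sqnorm u =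
  alpha / 2 * sqnorm z - alpha / 2 * sqnorm u - alpha / 2 * sqdist z u.
Proof. by rewrite sqdist_hdot; field. Qed.

Definition gauss_cst : R := (alpha / pi) ^+ n.

Lemma gauss_cst_gt0 : 0 < gauss_cst.
Proof. by rewrite exprn_gt0// divr_gt0// pi_gt0. Qed.

Lemma normc_toeplitz_integrand (phi f : Cn -> R[i]) (z u : Cn) :
  Normc.normc (toeplitz_integrand alpha phi f z u) =
  gauss_cst * expR (alpha / 2 * sqnorm z) *
    (kern alpha z u * (Normc.normc (phi u) * fock_density f u)).
Proof.
rewrite /toeplitz_integrand 3!Normc.normcM normc_cexp Re_scale.
rewrite normc_real; last by rewrite mulr_ge0 ?expR_ge0// ltW// gauss_cst_gt0.
rewrite /gauss -/gauss_cst /fock_density /kern.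
transitivity (gauss_cst * (Normc.normc (phi u) * Normc.normc (f u)) *
  (expR (alpha * complex.Re (hdot z u) - alpha * sqnorm u))).
  by rewrite expRD; ring.
by rewrite gaussian_exponent !expRD; ring.
Qed.

Variables (p : R) (w : Cn -> R) (phi : Cn -> R[i]) (w0 : Cn -> R) (phi0 : Cn -> R[i]).
Hypotheses (p_gt0 : 0 < p) (w_ge0 : forall z, 0 <= w z).
Hypotheses (mw0 : measurable_fun setT w0) (mphi0 : measurable_fun setT phi0).
Hypothesis w0_ge0 : forall z, 0 <= w0 z.
Hypothesis ww0 : {ae vol R n, forall z, w z = w0 z}.
Hypothesis phiphi0 : {ae vol R n, forall z, phi z = phi0 z}.

Lemma fock_int_ae (f f0 : Cn -> R[i]) : {ae vol R n, forall z, f z = f0 z} ->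
  fock_int alpha p w f =
  (\int[vol R n]_u (fock_density f0 u `^ p * w0 u)%:E)%E.
Proof.
move=> ff0; rewrite fock_intE; apply: ae_eq_lower_integral.
- by move=> u _; rewrite lee_fin mulr_ge0// powR_ge0.
- by move=> u _; rewrite lee_fin mulr_ge0// powR_ge0.
by apply: filterS2 ww0 ff0 => u -> fu _; rewrite /fock_density fu.
Qed.

Lemma integral_normc_toeplitz (f f0 : Cn -> R[i]) z :
  measurable_fun setT f0 -> {ae vol R n, forall z, f z = f0 z} ->
  (\int[vol R n]_u (Normc.normc (toeplitz_integrand alpha phi f z u))%:E)%E =
  ((gauss_cst * expR (alpha / 2 * sqnorm z))%:E *
   kop alpha (fun u => Normc.normc (phi0 u)) (fock_density f0) z)%E.
Proof.
move=> mf0 ff0; have c0 : 0 <= gauss_cst * expR (alpha / 2 * sqnorm z).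
  by rewrite mulr_ge0 ?expR_ge0// ltW// gauss_cst_gt0.
have k0 u : 0 <= kern alpha z u * (Normc.normc (phi0 u) * fock_density f0 u).
  by rewrite !mulr_ge0 ?normc_ge0 ?expR_ge0.
rewrite /kop -ge0_integralZl//; last 2 first.
- apply/measurable_EFinP; apply: measurable_funM; first exact: measurable_kern_center.
  apply: measurable_funM; first exact: measurable_normc_comp.
  exact: measurable_fock_density.
- by move=> u _; rewrite lee_fin.
apply: ae_eq_lower_integral => [u _|u _|].
- by rewrite lee_fin normc_ge0.
- by rewrite -EFinM lee_fin mulr_ge0.
apply: filterS2 phiphi0 ff0 => u pu fu _.
by rewrite normc_toeplitz_integrand EFinM /fock_density pu fu.
Qed.

(** The real and imaginary parts are bounded separately, hence the factor 2. *)
Lemma normc_toeplitz_le (f : Cn -> R[i]) z :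
  ((Normc.normc (toeplitz alpha phi f z))%:E <= 2%:E *
   \int[vol R n]_u (Normc.normc (toeplitz_integrand alpha phi f z u))%:E)%E.
Proof.
set I := integral _ _ _.
have part (F : Cn -> R) :
    (forall u, `|F u| <= Normc.normc (toeplitz_integrand alpha phi f z u)) ->
    ((`| \int[vol R n]_u F u |%R)%:E <= I)%E.
  move=> FI; apply: (@le_trans _ _ `| \int[vol R n]_u (F u)%:E |%E).
    rewrite /Rintegral; case: (integral _ _ _) => [x| |] //=; by rewrite normr0 leey.
  apply: le_trans (abse_lower_integral_le _ _ _) _.
  by apply: le_lower_integral => // u _; rewrite lee_fin.
have reim (a b : R) : Normc.normc (a +i* b) <= `|a| + `|b|.
  rewrite normcE /= -(@ler_pXn2r _ 2)// ?nnegrE ?sqrtr_ge0 ?addr_ge0//.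
  rewrite sqr_sqrtr ?addr_ge0 ?sqr_ge0// -(real_normK (num_real a)).
  by rewrite -(real_normK (num_real b)) sqrrD lerD2r lerDl mulrn_wge0// mulr_ge0.
have re (x : R[i]) : `|complex.Re x| <= Normc.normc x.
  by rewrite normcE -sqrtr_sqr ler_wsqrtr// lerDl sqr_ge0.
have im (x : R[i]) : `|complex.Im x| <= Normc.normc x.
  by rewrite normcE -sqrtr_sqr ler_wsqrtr// lerDr sqr_ge0.
apply: (@le_trans _ _ (I + I)%E).
  apply: le_trans (leeD (part _ (fun u => re _)) (part _ (fun u => im _))).
  by rewrite -EFinD lee_fin; exact: reim.
by rewrite mule_natl mule2n.
Qed.

(** The set where the defining integral diverges is the Borel set where [P] is
infinite; it is null for [w dv] because [P^p w0] is integrable. *)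
Lemma toeplitz_bounded_of_kop :
  kop_bounded alpha w0 (fun u => Normc.normc (phi0 u)) p ->
  toeplitz_bounded alpha p w phi.
Proof.
move=> [M M0 HM]; pose K := (2 * gauss_cst) `^ p * M.
have K0 : 0 <= K by rewrite mulr_ge0// powR_ge0.
exists (K `^ p^-1) => [|f [[f0 mf0 ff0] ffin]]; first exact: powR_ge0.
pose h u := Normc.normc (phi0 u).
pose g := fock_density f0.
have mg : measurable_fun setT g by exact: measurable_fock_density.
have mh : measurable_fun setT h by exact: measurable_normc_comp.
have g0 u : 0 <= g u by exact: fock_density_ge0.
pose P := kop alpha h g.
have P0 z : (0 <= P z)%E.
  apply: integral_ge0 => u _; rewrite lee_fin !mulr_ge0 ?normc_ge0//.
  exact: expR_ge0.
have mP : measurable_fun setT P.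
  apply: (measurable_fun_fubini_tonelli_F
    (fun zu : Cn * Cn => (kern alpha zu.1 zu.2 * (h zu.2 * g zu.2))%:E)).
  - apply/measurable_EFinP; apply: measurable_funM; first exact: measurable_kern.
    by apply: measurable_funM; exact: measurableT_comp.
  - by move=> zu; rewrite lee_fin !mulr_ge0 ?normc_ge0 ?expR_ge0.
have Pint := HM g mg g0; rewrite -/P -(fock_int_ae ff0) in Pint.
have mPw : measurable_fun setT (fun z => P z `^ p * (w0 z)%:E)%E.
  apply: emeasurable_funM; last exact/measurable_EFinP.
  exact: (measurableT_comp (measurable_poweR p)).
have Pw0 z : (0 <= P z `^ p * (w0 z)%:E)%E by rewrite mule_ge0 ?poweR_ge0 ?lee_fin.
split.
- exists [set z | P z = +oo%E]; split.
  + rewrite (_ : [set z | _] = P @^-1` [set +oo%E])//.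
    by rewrite -[X in measurable X]setTI; exact: mP.
  + have : (vol R n).-integrable setT (fun z => P z `^ p * (w0 z)%:E)%E.
      apply/integrableP; split=> //.
      under eq_integral do rewrite gee0_abs//.
      by apply: le_lt_trans Pint _; rewrite lte_mul_pinfty ?lee_fin.
    move=> /(integrable_ae measurableT) Pae.
    rewrite /wmeas -(integral0 (vol R n) [set z | P z = +oo%E]).
    apply: ae_eq_lower_integral => [u _|//|]; first by rewrite lee_fin.
    apply: filterS2 ww0 Pae => z -> /(_ I) + Pz; rewrite Pz poweRyr ?gt_eqF//.
    move: (w0_ge0 z); rewrite le_eqVlt => /predU1P[<-//|wz].
    by rewrite gt0_mulye// lte_fin.
  + move=> z /=; rewrite /toeplitz_cvg (integral_normc_toeplitz z mf0 ff0) -/h -/g -/P.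
    apply: contra_notP => Pz; rewrite lte_mul_pinfty//.
    * by rewrite lee_fin mulr_ge0 ?expR_ge0// ltW// gauss_cst_gt0.
    * by rewrite ltey; exact/eqP.
rewrite /fock_norm -poweR_EFin -poweRM ?lee_fin//; last first.
  by apply: integral_ge0 => u _; rewrite lee_fin !mulr_ge0 ?powR_ge0 ?expR_ge0.
apply: le_poweR; first by rewrite invr_ge0 ltW.
  by apply: integral_ge0 => u _; rewrite lee_fin !mulr_ge0 ?powR_ge0 ?expR_ge0.
rewrite /K EFinM -muleA; apply: (@le_trans _ _ (((2 * gauss_cst) `^ p)%:E *
    \int[vol R n]_z (P z `^ p * (w0 z)%:E))%E); last first.
  by rewrite lee_wpmul2l// lee_fin powR_ge0.
rewrite -ge0_integralZl//; last by rewrite lee_fin powR_ge0.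
rewrite fock_intE; apply: ae_le_lower_integral.
- by move=> u _; rewrite lee_fin mulr_ge0// powR_ge0.
- by move=> u _; rewrite mule_ge0// lee_fin powR_ge0.
apply: filterS ww0 => z -> _.
rewrite EFinM muleA lee_wpmul2r ?lee_fin//.
rewrite -!poweR_EFin -poweRM//; last by rewrite lee_fin mulr_ge0// ltW// gauss_cst_gt0.
apply: le_poweR; [exact: ltW|by rewrite lee_fin fock_density_ge0|].
rewrite /fock_density EFinM muleC.
apply: le_trans (lee_wpmul2l _ (normc_toeplitz_le f z)) _.
  by rewrite lee_fin expR_ge0.
rewrite (integral_normc_toeplitz z mf0 ff0) -/h -/g -/P.
rewrite !muleA -!EFinM lee_wpmul2r// lee_fin le_eqVlt; apply/orP; left; apply/eqP.
rewrite [LHS](_ : _ = 2 * gauss_cst *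
   (expR (- (alpha / 2 * sqnorm z)) * expR (alpha / 2 * sqnorm z))); last by ring.
by rewrite -expRD addNr expR0 mulr1.
Qed.

End toeplitz_upper.

(** * Lower bounds from test functions *)

Section rotation.
Context d (T : measurableType d) (R : realType) (mu : {measure set T -> \bar R}).

(** Projecting the complex number [int A e^(i theta)] onto the direction
[e^(i tau)] turns it into [int A cos (theta - tau)]. *)
Lemma rotated_integral_ge (A theta : T -> R) (tau : R) :
  measurable_fun setT theta -> mu.-integrable setT (EFin \o A) ->
  (forall u, 0 <= A u) -> (forall u, A u != 0 -> 1 / 2 <= cos (theta u - tau)) ->
  (\int[mu]_u A u) / 2 <=
  Normc.normc ((\int[mu]_u (A u * cos (theta u))) +i*
               (\int[mu]_u (A u * sin (theta u)))).
Proof.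
move=> mth iA A0 Ac.
have mA : measurable_fun setT A by apply/measurable_EFinP; case/integrableP: iA.
have mcos : measurable_fun setT (fun u => cos (theta u)).
  exact: (measurableT_comp (continuous_measurable_fun (@continuous_cos R))).
have msin : measurable_fun setT (fun u => sin (theta u)).
  exact: (measurableT_comp (continuous_measurable_fun (@continuous_sin R))).
have dom (k : T -> R) : measurable_fun setT k -> (forall u, `|k u| <= 1) ->
    mu.-integrable setT (EFin \o (fun u => A u * k u)).
  move=> mk k1; apply: le_integrable iA => //.
    by apply/measurable_EFinP; exact: measurable_funM.
  by move=> u _; rewrite lee_fin normrM ler_piMr.
have ic := dom _ mcos (fun u => cos_max _).
have is_ := dom _ msin (fun u => sin_max _).
have iZ (k : T -> R) (a : R) : mu.-integrable setT (EFin \o k) ->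
    mu.-integrable setT (EFin \o (fun u => a * k u)).
  by move=> ik; exact: (integrableZl measurableT a ik).
apply: (@le_trans _ _ (cos tau * (\int[mu]_u (A u * cos (theta u))) +
                      sin tau * (\int[mu]_u (A u * sin (theta u))))).
  rewrite -!RintegralZl// -RintegralD//; [|exact: iZ|exact: iZ].
  rewrite mulrC -RintegralZl//; apply: le_Rintegral => //; first exact: iZ.
    have := integrableD measurableT (iZ _ (cos tau) ic) (iZ _ (sin tau) is_).
    by apply: eq_integrable => // u _.
  move=> u _.
  have -> : cos tau * (A u * cos (theta u)) + sin tau * (A u * sin (theta u)) =
     A u * cos (theta u - tau) by rewrite cosB; ring.
  have [->|/Ac] := eqVneq (A u) 0; first by rewrite mulr0 mul0r.
  by move=> c12; rewrite mulrC ler_wpM2l// -div1r.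
set a := Rintegral _ _ _; set b := Rintegral _ _ _.
rewrite normcE /=; apply: le_trans (ler_norm _) _.
rewrite -sqrtr_sqr ler_wsqrtr// -subr_ge0.
rewrite (_ : _ - _ = (sin tau * a - cos tau * b) ^+ 2); first exact: sqr_ge0.
transitivity ((cos tau ^+ 2 + sin tau ^+ 2) * (a ^+ 2 + b ^+ 2) -
  (cos tau * a + sin tau * b) ^+ 2); first by rewrite cos2Dsin2 mul1r.
by ring.
Qed.

End rotation.

Section toeplitz_lower.
Variables (R : realType) (n : nat) (alpha r : R).
Hypotheses (alpha_gt0 : 0 < alpha) (r_gt0 : 0 < r).
Local Notation Cn := (Cspace R n).

Lemma Im_hdot (z u : Cn) : complex.Im (hdot z u) =
  \sum_(j < n) (complex.Im (tnth z j) * complex.Re (tnth u j) -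
                complex.Re (tnth z j) * complex.Im (tnth u j)).
Proof.
rewrite /hdot Im_sum; apply: eq_bigr => j _.
by case: (tnth z j) => a b; case: (tnth u j) => c e /=; ring.
Qed.

(** The left side is [|Im <z - y, u - y>|]: a second-order variation, which is
why it is small for [z] near [y] although [<z, u>] is unbounded. *)
Lemma phase_variation_le (y z u : Cn) (d s : R) : cube y d z -> cube y s u ->
  `|(complex.Im (hdot z u) - complex.Im (hdot y u)) -
    (complex.Im (hdot z y) - complex.Im (hdot y y))| <= n%:R * (d * s / 2).
Proof.
move=> yz yu; rewrite !Im_hdot -!sumrB.
apply: le_trans (ler_norm_sum _ _ _) _.
rewrite -[X in X%:R * _](card_ord n) mulr_natl -sumr_const.
apply: ler_sum => j _; have [zr zi] := yz j; have [ur ui] := yu j.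
rewrite (_ : _ - _ =
  (complex.Im (tnth z j) - complex.Im (tnth y j)) *
  (complex.Re (tnth u j) - complex.Re (tnth y j)) -
  (complex.Re (tnth z j) - complex.Re (tnth y j)) *
  (complex.Im (tnth u j) - complex.Im (tnth y j))); last by ring.
apply: le_trans (ler_normB _ _) _; rewrite !normrM.
apply: le_trans (lerD (ler_pM _ _ zi ur) (ler_pM _ _ zr ui)) _ => //.
by rewrite le_eqVlt; apply/orP; left; apply/eqP; field.
Qed.

Lemma sqdist_cube_le (z u : Cn) (s : R) : cube z s u ->
  sqdist z u <= n%:R * (s ^+ 2 / 2).
Proof.
move=> zu; rewrite -[X in X%:R * _](card_ord n) mulr_natl -sumr_const.
apply: ler_sum => j _; have [ur ui] := zu j.
have sq (a b : R) : `|b - a| <= s / 2 -> (a - b) ^+ 2 <= s ^+ 2 / 4.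
  move=> ab; rewrite -(real_normK (num_real _)) distrC.
  have s0 : 0 <= s / 2 by apply: le_trans ab.
  rewrite (_ : s ^+ 2 / 4 = (s / 2) ^+ 2); last by field.
  by rewrite lerXn2r// nnegrE.
apply: le_trans (lerD (sq _ _ ur) (sq _ _ ui)) _.
by rewrite le_eqVlt; apply/orP; left; apply/eqP; field.
Qed.

(** The size [dl] of the neighbourhood of [y] on which the phases of all points of
a cube of side [r] agree; it depends on [alpha], [n] and [r] only, not on the
position of the cube. *)
Lemma exists_small_angle : exists2 dl : R, 0 < dl <= r &
  forall t : R, `|t| <= alpha * (n%:R * (dl * (2 * r + dl) / 2)) ->
  1 / 2 <= cos t.
Proof.
have /cvgrPdist_lt /(_ (1 / 2)) := @continuous_cos R 0.
rewrite divr_gt0// => /(_ isT) /nbhs_ballP[e /= e0 He].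
have He' t : `|t| < e -> 1 / 2 <= cos t.
  move=> te; have := He t; rewrite /ball/= sub0r normrN => /(_ te).
  by rewrite cos0 => /(le_lt_trans (ler_norm _)); lra.
pose k := 1 + alpha * (n%:R * (3 * r / 2)).
have k0 : 0 < k by rewrite ltr_wpDr// !mulr_ge0// ltW.
pose dl := Num.min r (e / (2 * k)).
have dl0 : 0 < dl by rewrite lt_min r_gt0 divr_gt0// mulr_gt0.
have dlr : dl <= r by rewrite ge_min lexx.
exists dl; first by rewrite dl0.
move=> t te; apply: He'; apply: le_lt_trans te _.
apply: (@le_lt_trans _ _ (k * dl)).
  have -> : k * dl = dl + alpha * (n%:R * (dl * (3 * r) / 2)) by rewrite /k; field.
  apply: ler_wpDl; first exact: ltW.
  rewrite ler_pM2l// ler_wpM2l// ler_pM2r ?invr_gt0// ler_pM2l//.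
  by move: dlr; lra.
have : dl <= e / (2 * k) by rewrite ge_min lexx orbT.
rewrite ler_pdivlMr ?mulr_gt0// => H.
have : 0 < dl * k by rewrite mulr_gt0.
by move: H; lra.
Qed.

Definition cis (t : R) : R[i] := cos t +i* sin t.

Lemma cisM s t : cis s * cis t = cis (s + t).
Proof.
rewrite /cis cosD sinD; apply/eqP; rewrite eq_complex /=.
by apply/andP; split; apply/eqP; ring.
Qed.

Lemma normc_cis t : Normc.normc (cis t) = 1.
Proof. by rewrite normcE /= cos2Dsin2 sqrtr1. Qed.

Lemma normc_conj (z : R[i]) : Normc.normc (conjc z) = Normc.normc z.
Proof. by case: z => a b; rewrite !normcE /= sqrrN. Qed.

(** Where [z] is 0 both sides are 0, as division by 0 gives 0. *)
Lemma mul_phase (c : R) (z : R[i]) :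
  z * ((c / Normc.normc z)%:C * conjc z) = (c * Normc.normc z)%:C.
Proof.
have [->|z0] := eqVneq z 0; first by rewrite mul0r Normc.normc0 mulr0.
have Nz : Normc.normc z != 0 by apply: contra z0 => /eqP/Normc.eq0_normc ->.
have Nz2 : Normc.normc z ^+ 2 = complex.Re z ^+ 2 + complex.Im z ^+ 2.
  by rewrite normcE sqr_sqrtr// addr_ge0 ?sqr_ge0.
have -> : c * Normc.normc z = c / Normc.normc z * Normc.normc z ^+ 2.
  by field.
rewrite Nz2; case: z {z0 Nz Nz2} => a b /=; move: (c / _) => k.
by apply/eqP; rewrite eq_complex /=; apply/andP; split; apply/eqP; ring.
Qed.

Variables (p : R) (w : Cn -> R) (phi : Cn -> R[i]) (w0 : Cn -> R) (phi0 : Cn -> R[i]).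
Hypotheses (p_gt0 : 0 < p) (w_ge0 : forall z, 0 <= w z).
Hypotheses (mw0 : measurable_fun setT w0) (mphi0 : measurable_fun setT phi0).
Hypothesis w0_ge0 : forall z, 0 <= w0 z.
Hypothesis ww0 : {ae vol R n, forall z, w z = w0 z}.
Hypothesis phiphi0 : {ae vol R n, forall z, phi z = phi0 z}.
Variable M : R.
Hypothesis phi0_le : forall u, Normc.normc (phi0 u) <= M.
Local Notation h := (fun u => Normc.normc (phi0 u)).

(** Supported in [cube x r], with Fock density at most [psi]; its phase cancels
that of the symbol and that of the reproducing kernel at [y]. *)
Definition test_fun (x y : Cn) (psi : Cn -> R) (u : Cn) : R[i] :=
  (\1_(cube x r) u * psi u * expR (alpha / 2 * sqnorm u) / Normc.normc (phi0 u))%:C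
  * conjc (phi0 u) * cis (- (alpha * complex.Im (hdot y u))).

Lemma measurable_hdot_Im y : measurable_fun setT (fun u : Cn => complex.Im (hdot y u) : R).
Proof.
rewrite (_ : (fun u => _) = fun u => \sum_(j < n)
  (complex.Im (tnth y j) * complex.Re (tnth u j) -
   complex.Re (tnth y j) * complex.Im (tnth u j))); last first.
  by apply/funext => u; rewrite Im_hdot.
apply: measurable_sum => j; apply: measurable_funB; apply: measurable_funM => //.
- exact: (@measurable_Re_tnth R _ _ n j id).
- exact: (@measurable_Im_tnth R _ _ n j id).
Qed.

Section one_test.
Variables (x y : Cn) (psi : Cn -> R) (N : R).
Hypotheses (mpsi : measurable_fun setT psi) (psi_ge0 : forall u, 0 <= psi u).
Hypothesis psi_le : forall u, psi u <= N.
Local Notation Q := (cube x r).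
Local Notation f := (test_fun x y psi).

Let mQ : measurable_fun setT (\1_Q : Cn -> R).
Proof. by apply: measurable_indic; exact: measurable_cube. Qed.

Lemma measurable_test_fun : measurable_fun setT f.
Proof.
have mt : measurable_fun setT (fun u : Cn => - (alpha * complex.Im (hdot y u))).
  apply: measurableT_comp => //; apply: measurable_funM => //.
  exact: measurable_hdot_Im.
apply: measurable_mulc; first apply: measurable_mulc.
- apply: measurable_complexP => //=.
  apply: measurable_funM.
    apply: measurable_funM; first exact: measurable_funM.
    apply: (measurableT_comp (@measurable_expR _)).
    by apply: measurable_funM => //; exact: measurable_sqnorm.
  by apply: measurable_inv_ge0 => [|u]; [exact: measurable_normc_comp|exact: normc_ge0].
- apply: measurable_complexP.
  + rewrite (_ : (fun u => _) = fun u => complex.Re (phi0 u)); last first.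
      by apply/funext => u; case: (phi0 u).
    exact: measurable_Re_comp.
  + rewrite (_ : (fun u => _) = fun u => - complex.Im (phi0 u)); last first.
      by apply/funext => u; case: (phi0 u).
    by apply: measurableT_comp => //; exact: measurable_Im_comp.
- apply: measurable_complexP => /=.
  + exact: (measurableT_comp (continuous_measurable_fun (@continuous_cos R))).
  + exact: (measurableT_comp (continuous_measurable_fun (@continuous_sin R))).
Qed.

Lemma fock_density_test_le u : fock_density alpha f u <= \1_Q u * psi u.
Proof.
have c0 : 0 <= \1_Q u * psi u by rewrite mulr_ge0.
rewrite /fock_density /test_fun; move: (alpha / 2 * sqnorm u) => s.
rewrite !Normc.normcM normc_cis mulr1 normc_conj.
rewrite normc_real; last by rewrite !mulr_ge0 ?expR_ge0// invr_ge0 normc_ge0.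
have [->|N0] := eqVneq (Normc.normc (phi0 u)) 0; first by rewrite mulr0 mul0r.
rewrite mulfVK// -[leLHS]mulrA -expRD subrr expR0 mulr1//.
Qed.

Lemma fock_int_test_le : (fock_int alpha p w f <=
  \int[vol R n]_(u in Q) (psi u `^ p * w0 u)%:E)%E.
Proof.
rewrite (fock_int_ae alpha p w_ge0 w0_ge0 ww0 (f0 := f)); last exact: aeW.
rewrite -(integral_indicr _ Q); apply: le_lower_integral => u _.
  by rewrite lee_fin mulr_ge0// powR_ge0.
rewrite -EFinM lee_fin mulrAC ler_wpM2r//.
apply: (@le_trans _ _ ((\1_Q u * psi u) `^ p)).
  apply: ge0_ler_powR (fock_density_test_le u).
  - exact: ltW.
  - by rewrite nnegrE fock_density_ge0.
  - by rewrite nnegrE mulr_ge0.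
rewrite powRM// indicE; case: (_ \in _); first by rewrite powR1 mul1r mulr1.
by rewrite powR0 ?gt_eqF// mul0r mulr0.
Qed.

(** The modulus of the Toeplitz integrand of the test function. *)
Definition amplitude (z u : Cn) : R := gauss_cst n alpha * expR (alpha / 2 * sqnorm z) *
  (kern alpha z u * (Normc.normc (phi0 u) * (\1_Q u * psi u))).

Lemma toeplitz_integrand_test z u : phi u = phi0 u ->
  toeplitz_integrand alpha phi f z u = (amplitude z u)%:C *
   cis (alpha * complex.Im (hdot z u) - alpha * complex.Im (hdot y u)).
Proof.
move=> pu; rewrite /toeplitz_integrand pu /test_fun /cexp -/(cis _) Re_scale Im_scale.
set c := _ * _ * expR _.
transitivity (phi0 u * ((c / Normc.normc (phi0 u))%:C * conjc (phi0 u)) *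
  ((expR (alpha * complex.Re (hdot z u)))%:C * (gauss alpha u)%:C) *
  (cis (alpha * complex.Im (hdot z u)) * cis (- (alpha * complex.Im (hdot y u))))).
  by ring.
rewrite mul_phase cisM; congr (_ * _); rewrite -!rmorphM; congr (_%:C).
rewrite /c /gauss /amplitude -/(gauss_cst n alpha) /kern.
transitivity (gauss_cst n alpha * (\1_Q u * psi u * Normc.normc (phi0 u)) *
  expR (alpha / 2 * sqnorm u + (alpha * complex.Re (hdot z u) - alpha * sqnorm u))).
  by rewrite !expRD; ring.
by rewrite gaussian_exponent !expRD !expRN; field; rewrite !gt_eqF ?expR_gt0.
Qed.

Lemma amplitude_ge0 z u : 0 <= amplitude z u.
Proof.
by rewrite !mulr_ge0 ?expR_ge0 ?normc_ge0// ltW// gauss_cst_gt0.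
Qed.

Lemma measurable_amplitude z : measurable_fun setT (amplitude z).
Proof.
apply: measurable_funM => //; apply: measurable_funM; first exact: measurable_kern_center.
apply: measurable_funM; first exact: measurable_normc_comp.
exact: measurable_funM.
Qed.

Lemma kern_le1 (z u : Cn) : kern alpha z u <= 1.
Proof.
by rewrite -expR0 ler_expR oppr_le0 mulr_ge0 ?sqdist_ge0// divr_ge0// ltW.
Qed.

Lemma integrable_amplitude z : (vol R n).-integrable setT (EFin \o amplitude z).
Proof.
pose K := gauss_cst n alpha * expR (alpha / 2 * sqnorm z) * (M * N).
have N0 : 0 <= N by exact: le_trans (psi_le x).
have M0 : 0 <= M by exact: le_trans (normc_ge0 _) (phi0_le x).
apply/integrableP; split; first by apply/measurable_EFinP; exact: measurable_amplitude.
apply: (@le_lt_trans _ _ (\int[vol R n]_(u in Q) cst K%:E u)%E).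
  rewrite -(integral_indicr _ Q); apply: le_lower_integral => // u _ /=.
  rewrite (ger0_norm (amplitude_ge0 z u)) -EFinM lee_fin /amplitude /K.
  set c := _ * expR _; have c0 : 0 <= c.
    by rewrite mulr_ge0 ?expR_ge0// ltW// gauss_cst_gt0.
  rewrite (_ : c * (kern _ _ _ * _) =
    c * (kern alpha z u * (Normc.normc (phi0 u) * psi u)) * \1_Q u); last by ring.
  rewrite ler_wpM2r// ler_wpM2l// -[leRHS]mul1r.
  apply: ler_pM; rewrite ?mulr_ge0 ?normc_ge0 ?kern_le1 ?expR_ge0//.
  by apply: ler_pM; rewrite ?normc_ge0.
rewrite integral_cst; last exact: measurable_cube.
have Vfin : (vol R n Q < +oo)%E by rewrite (vol_cube x (ltW r_gt0)) ltry.
apply: lte_mul_pinfty => //; rewrite lee_fin !mulr_ge0 ?expR_ge0//.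
by rewrite ltW// gauss_cst_gt0.
Qed.

Definition lower_cst : R :=
  gauss_cst n alpha * expR (- (alpha * (4 * n%:R * r ^+ 2))) / 2.

Lemma lower_cst_gt0 : 0 < lower_cst.
Proof. by rewrite divr_gt0// mulr_gt0 ?expR_gt0// gauss_cst_gt0. Qed.

(** For [z] close to [y] all the values of the integrand lie within a small
angle of a common direction, so the modulus of the integral is at least half
the integral of the amplitude, where the Gaussian kernel is bounded below since
[z] and [u] are at distance O(r). *)
Lemma toeplitz_test_ge (z : Cn) (dl : R) : 0 < dl <= r ->
  (forall t : R, `|t| <= alpha * (n%:R * (dl * (2 * r + dl) / 2)) -> 1 / 2 <= cos t) ->
  cube y dl z -> cube x (r + dl) y ->
  (lower_cst%:E * \int[vol R n]_(u in Q) (Normc.normc (phi0 u) * psi u)%:E <=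
  (fock_density alpha (toeplitz alpha phi f) z)%:E)%E.
Proof.
move=> /andP[d0 dr] small yz xy.
have Qy u : Q u -> cube y (2 * r + dl) u.
  move=> xu; have := cube_trans (cube_sym xy) xu.
  by rewrite (_ : r + dl + r = 2 * r + dl)//; ring.
have Qz u : Q u -> cube z (4 * r) u.
  move=> xu; have := cube_trans (cube_sym yz) (Qy u xu).
  by apply: le_cube; move: dr; lra.
pose theta u := alpha * complex.Im (hdot z u) - alpha * complex.Im (hdot y u).
pose tau := theta y.
have mth : measurable_fun setT theta.
  by apply: measurable_funB; apply: measurable_funM => //; exact: measurable_hdot_Im.
have ampQ u : amplitude z u != 0 -> Q u.
  rewrite /amplitude indicE; case: (boolP (u \in Q)) => [/set_mem//|_].
  by rewrite mul0r !mulr0 eqxx.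
have cosge u : amplitude z u != 0 -> 1 / 2 <= cos (theta u - tau).
  move=> /ampQ xu; apply: small; rewrite /tau /theta -!mulrBr normrM gtr0_norm//.
  by rewrite ler_pM2l//; apply: phase_variation_le => //; exact: Qy.
have rot := rotated_integral_ge mth (integrable_amplitude z) (amplitude_ge0 z) cosge.
have TE : toeplitz alpha phi f z =
    (\int[vol R n]_u (amplitude z u * cos (theta u))) +i*
    (\int[vol R n]_u (amplitude z u * sin (theta u))).
  rewrite /toeplitz /Rintegral; congr (fine _ +i* fine _);
    apply: ae_eq_signed_lower_integral; apply: filterS phiphi0 => u pu _;
    rewrite toeplitz_integrand_test// -/(theta u) /cis.
  - by rewrite Re_scale.
  - by rewrite Im_scale.
have Afin := integrable_fin_num measurableT (integrable_amplitude z).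
have AE : ((\int[vol R n]_u amplitude z u)%:E = \int[vol R n]_u (amplitude z u)%:E)%E.
  by rewrite /Rintegral fineK.
rewrite /fock_density TE [X in (_ <= X)%E]EFinM [X in (_ <= X)%E]muleC.
apply: (@le_trans _ _ ((expR (- (alpha / 2 * sqnorm z)))%:E *
  ((\int[vol R n]_u amplitude z u)%R / 2)%:E)%E); last first.
  by rewrite lee_wpmul2l ?lee_fin ?expR_ge0.
have ma : measurable_fun setT (EFin \o amplitude z).
  by apply/measurable_EFinP; exact: measurable_amplitude.
set e := expR _; have e0 : 0 <= e / 2 by rewrite divr_ge0 ?expR_ge0.
have -> : (e%:E * ((\int[vol R n]_u amplitude z u)%R / 2)%:E =
    \int[vol R n]_u ((e / 2)%:E * (amplitude z u)%:E))%E.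
  rewrite ge0_integralZl//; last by move=> u _; rewrite lee_fin amplitude_ge0.
  by rewrite -AE -!EFinM; congr EFin; ring.
rewrite -(integral_indicr _ Q) -ge0_integralZl//; last 3 first.
- apply: emeasurable_funM; last first.
    by apply: (measurable_indic_comp (f := id)); first exact: measurable_cube.
  by apply/measurable_EFinP; apply: measurable_funM => //; exact: measurable_normc_comp.
- by move=> u _; rewrite -EFinM lee_fin !mulr_ge0 ?normc_ge0.
- by rewrite lee_fin ltW// lower_cst_gt0.
apply: le_lower_integral => u _.
  by rewrite -!EFinM lee_fin mulr_ge0 ?(ltW lower_cst_gt0)// mulr_ge0// mulr_ge0 ?normc_ge0.
rewrite -!EFinM lee_fin /amplitude indicE.
have [/set_mem xu|] := boolP (u \in Q); last by rewrite /= !(mul0r, mulr0).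
rewrite mulr1 mul1r /lower_cst.
have ker : expR (- (alpha * (4 * n%:R * r ^+ 2))) <= kern alpha z u.
  rewrite /kern ler_expR lerN2.
  rewrite [leRHS](_ : _ = alpha / 2 * (n%:R * ((4 * r) ^+ 2 / 2))); last by field.
  by rewrite ler_pM2l ?divr_gt0// sqdist_cube_le//; exact: Qz.
rewrite [leRHS](_ : _ = gauss_cst n alpha * kern alpha z u / 2 *
  (Normc.normc (phi0 u) * psi u) *
  (e * expR (alpha / 2 * sqnorm z))); last by ring.
rewrite -expRD addNr expR0 mulr1 ler_wpM2r ?mulr_ge0 ?normc_ge0//.
by rewrite ler_pM2r ?invr_gt0// ler_pM2l// gauss_cst_gt0.
Qed.

End one_test.

(** For each [y] near [cube x r] the test function bounds
[w0 (cube y dl) (int h psi)^p] by [int psi^p w0]. The weight is doubling at scale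
[r] only, and may vanish on the small cube [cube y dl]; but [cube_averaging] over
[y] recovers the mass of the whole [cube x r]. *)
Lemma toeplitz_bounded_test : toeplitz_bounded alpha p w phi ->
  exists2 K : R, 0 <= K &
  forall (x : Cn) (psi : Cn -> R) (N : R), measurable_fun setT psi ->
  (forall u, 0 <= psi u) -> (forall u, psi u <= N) ->
  (\int[vol R n]_(u in cube x r) (psi u `^ p * w0 u)%:E < +oo)%E ->
  ((\int[vol R n]_(u in cube x r) (w0 u)%:E) *
   (\int[vol R n]_(u in cube x r) (Normc.normc (phi0 u) * psi u)%:E) `^ p <=
   K%:E * \int[vol R n]_(u in cube x r) (psi u `^ p * w0 u)%:E)%E.
Proof.
move=> [C C0 TC]; have [dl /andP[d0 dr] small] := exists_small_angle.
have rd0 : 0 < r + dl by rewrite addr_gt0.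
have c0 := lower_cst_gt0.
pose K := ((r + dl) ^+ 2) ^+ n * C `^ p / lower_cst `^ p / (dl ^+ 2) ^+ n.
exists K.
  by rewrite !mulr_ge0 ?invr_ge0 ?powR_ge0 ?exprn_ge0// ltW.
move=> x psi N mpsi psi0 psiN Ifin.
set J := integral _ _ (fun u => (Normc.normc (phi0 u) * psi u)%:E).
set I := integral _ _ (fun u => (psi u `^ p * w0 u)%:E).
have J0 : (0 <= J)%E.
  by apply: integral_ge0 => u _; rewrite lee_fin mulr_ge0 ?normc_ge0.
have I0 : (0 <= I)%E.
  by apply: integral_ge0 => u _; rewrite lee_fin mulr_ge0 ?powR_ge0.
rewrite -/I in Ifin.
pose L := ((lower_cst%:E * J) `^ p)%E.
have L0 : (0 <= L)%E by exact: poweR_ge0.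
pose H (u : Cn) := ((w0 u)%:E * L)%E.
have H0 u : (0 <= H u)%E by rewrite mule_ge0 ?lee_fin.
have mH : measurable_fun setT H.
  by apply: emeasurable_funM => //; exact/measurable_EFinP.
have B0 : (0 <= (C `^ p)%:E * I)%E by rewrite mule_ge0// lee_fin powR_ge0.
have HB y : cube x (r + dl) y ->
    (\int[vol R n]_(u in cube y dl) H u <= (C `^ p)%:E * I)%E.
  move=> xy; pose f := test_fun x y psi.
  have fI : (fock_int alpha p w f <= I)%E by exact: fock_int_test_le.
  have fp (k : Cn -> R[i]) : (0 <= fock_int alpha p w k)%E.
    by rewrite fock_intE; apply: integral_ge0 => u _; rewrite lee_fin mulr_ge0// powR_ge0.
  have ff : in_fock alpha p w f.
    split; last exact: le_lt_trans fI Ifin.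
    by exists f; [exact: measurable_test_fun|exact: aeW].
  have [_ Tf] := TC f ff.
  have {}Tf : (fock_int alpha p w (toeplitz alpha phi f) <= (C `^ p)%:E * I)%E.
    have := le_poweR (ltW p_gt0) (poweR_ge0 _ _) Tf.
    rewrite poweRM ?poweR_ge0 ?lee_fin// /fock_norm -!poweRrM mulVf ?gt_eqF//.
    rewrite !poweRe1// => /le_trans; apply.
    by rewrite poweR_EFin lee_wpmul2l// lee_fin powR_ge0.
  apply: le_trans Tf; rewrite fock_intE -(integral_indicr _ (cube y dl)).
  apply: ae_le_lower_integral => [u _|u _|].
  - by rewrite mule_ge0 ?lee_fin.
  - by rewrite lee_fin mulr_ge0// powR_ge0.
  apply: filterS ww0 => u -> _; rewrite indicE.
  have [/set_mem yu|_] := boolP (u \in cube y dl); last first.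
    by rewrite mule0 lee_fin mulr_ge0// powR_ge0.
  rewrite mule1 /H muleC EFinM lee_wpmul2r ?lee_fin// /L -poweR_EFin.
  apply: le_poweR; first exact: ltW.
    by rewrite mule_ge0// lee_fin ltW.
  by apply: (toeplitz_test_ge mpsi psi0 psiN _ small) => //; rewrite d0.
have := cube_averaging (ltW r_gt0) (ltW d0) mH H0 B0 HB.
set W := integral _ _ (fun u => (w0 u)%:E).
have W0 : (0 <= W)%E by apply: integral_ge0 => u _; rewrite lee_fin.
have -> : (\int[vol R n]_(u in cube x r) H u = W * L)%E.
  rewrite /H ge0_integralZr//.
  - exact: measurable_cube.
  - by apply/measurable_EFinP; exact: measurable_funTS.
  - by move=> u _; rewrite lee_fin.
rewrite /L poweRM//; last by rewrite lee_fin ltW.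
rewrite poweR_EFin.
have l0 : 0 < lower_cst `^ p by rewrite powR_gt0.
have a0 : 0 < (dl ^+ 2) ^+ n by rewrite !exprn_gt0.
have ial : 0 <= ((dl ^+ 2) ^+ n * lower_cst `^ p)^-1.
  by rewrite invr_ge0 mulr_ge0// ltW.
move: l0 a0 ial; rewrite /K; move: (lower_cst `^ p) (_ ^+ 2 ^+ n) (_ ^+ 2 ^+ n) (C `^ p).
move=> l b a c l0 a0 ial.
move=> /(lee_wpmul2l (x := ((a * l)^-1)%:E)) -/(_ ial).
have -> : (((a * l)^-1)%:E * (a%:E * (W * (l%:E * J `^ p))) = W * J `^ p)%E.
  rewrite (muleCA W) !muleA -!EFinM -mulrA mulVf ?mul1e//.
  by rewrite mulf_neq0 ?gt_eqF.
move=> /le_trans; apply; rewrite !muleA -!EFinM lee_wpmul2r// lee_fin.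
rewrite le_eqVlt; apply/orP; left; apply/eqP; field.
by rewrite !gt_eqF.
Qed.

End toeplitz_lower.

(** * The cube conditions *)

Section criteria.
Variables (R : realType) (n : nat) (alpha r : R).
Hypotheses (alpha_gt0 : 0 < alpha) (r_gt0 : 0 < r).
Local Notation Cn := (Cspace R n).
Local Notation V := ((r ^+ 2) ^+ n).

Let V_gt0 : 0 < V. Proof. by rewrite !exprn_gt0. Qed.

(** An uncountable family of local null sets: [kern_growth] with [B = 0] shows that
the Gaussian measure of [A] is 0. *)
Lemma null_of_cubes (A : set Cn) : measurable A ->
  (forall x, (\int[vol R n]_(u in cube x r) (\1_A u)%:E = 0)%E) ->
  {ae vol R n, forall u, ~ A u}.
Proof.
move=> mA A0; have [M M0 HM] := kern_growth n r_gt0 alpha_gt0 (@ltr01 R).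
have m1 : measurable_fun setT (fun u : Cn => (\1_A u)%:E : \bar R).
  exact: (measurable_indic_comp (f := id)).
pose z : Cn := [tuple 0 | _ < n].
have := HM _ z 0 m1 (fun u => _) (lexx _); rewrite mulr0 => H.
have {}H : (\int[vol R n]_u ((kern alpha z u)%:E * (\1_A u)%:E) <= 0)%E.
  apply: H => [u|m x _]; first by rewrite lee_fin.
  by rewrite A0 mul0r.
have mk : measurable_fun setT (fun u => (kern alpha z u)%:E * (\1_A u)%:E)%E.
  by apply: emeasurable_funM => //; apply/measurable_EFinP; exact: measurable_kern_center.
have : (\int[vol R n]_u `|(kern alpha z u)%:E * (\1_A u)%:E| = 0)%E.
  apply/eqP; rewrite eq_le integral_ge0// andbT; apply: le_trans H.
  apply: le_lower_integral => // u _.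
  by rewrite gee0_abs// mule_ge0 ?lee_fin// ltW// kern_gt0.
move=> /(ae_eq_integral_abs _ measurableT mk); apply: filterS => u /(_ I) /= + Au.
rewrite indicE mem_set// -EFinM mulr1 => -[] /eqP.
by rewrite gt_eqF// kern_gt0.
Qed.

Lemma average_cubeE (z : Cn) (g : Cn -> \bar R) :
  average (cube z r) g = (V^-1%:E * \int[vol R n]_(u in cube z r) g u)%E.
Proof.
by rewrite /average; congr (_%:E * _)%E; congr (_^-1); rewrite (vol_cube z (ltW r_gt0)).
Qed.

Lemma ereal_sup_ltyP (T : Type) (F : T -> \bar R) :
  (ereal_sup [set F z | z in [set: T]] < +oo)%E <->
  exists2 S : R, 0 <= S & forall z, (F z <= S%:E)%E.
Proof.
split=> [supF|[S S0 FS]]; last first.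
  apply: (@le_lt_trans _ _ S%:E); last exact: ltry.
  by apply: ge_ereal_sup => _ [z _ <-].
exists (Num.max 0 (fine (ereal_sup [set F z | z in [set: T]]))).
  by rewrite le_max lexx.
move=> z; apply: (@le_trans _ _ (ereal_sup [set F z | z in [set: T]])).
  by apply: ereal_sup_ubound; exists z.
case: (ereal_sup _) supF => [x| |]//= _; first by rewrite lee_fin le_max lexx orbT.
by rewrite leNye.
Qed.

Variables (w : Cn -> R) (phi : Cn -> R[i]) (w0 : Cn -> R) (phi0 : Cn -> R[i]).
Hypothesis w_ge0 : forall z, 0 <= w z.
Hypotheses (mw0 : measurable_fun setT w0) (mphi0 : measurable_fun setT phi0).
Hypothesis w0_ge0 : forall z, 0 <= w0 z.
Hypothesis ww0 : {ae vol R n, forall z, w z = w0 z}.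
Hypothesis phiphi0 : {ae vol R n, forall z, phi z = phi0 z}.
Local Notation h := (fun u => Normc.normc (phi0 u)).
Local Notation W z := (\int[vol R n]_(u in cube z r) (w0 u)%:E)%E.
Hypothesis W_fin : forall z, (W z < +oo)%E.
Local Notation cube_mass := (cube_mass r w0).

Let h_ge0 u : 0 <= h u. Proof. exact: normc_ge0. Qed.
Let mh : measurable_fun setT h. Proof. exact: measurable_normc_comp. Qed.

Lemma average_weight z : average (cube z r) (fun u => (w u)%:E) = (V^-1 * cube_mass z)%:E.
Proof.
rewrite average_cubeE EFinM -cube_massE//; congr (_ * _)%E.
apply: ae_eq_lower_integral => [u _|u _|]; rewrite ?lee_fin//.
by apply: filterS ww0 => u ->.
Qed.

Definition dual_density (p' s : R) (u : Cn) : \bar R :=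
  ((h u `^ p')%:E * epow (w0 u) (- s))%E.

Lemma epow_ge0 (t a : R) : (0 <= epow t a)%E.
Proof. by rewrite /epow; case: ifP => // _; rewrite lee_fin powR_ge0. Qed.

Lemma average_dual p' s z :
  average (cube z r) (fun u => (Normc.normc (phi u) `^ p')%:E * epow (w u) (- s))%E =
  (V^-1%:E * \int[vol R n]_(u in cube z r) dual_density p' s u)%E.
Proof.
rewrite average_cubeE; congr (_ * _)%E; apply: ae_eq_lower_integral => [u _|u _|].
- by rewrite mule_ge0 ?epow_ge0// lee_fin powR_ge0.
- by rewrite mule_ge0 ?epow_ge0// lee_fin powR_ge0.
by apply: filterS2 ww0 phiphi0 => u wu pu _; rewrite /dual_density wu pu.
Qed.

Lemma dual_density_zero p' s u : 0 < s -> 0 < p' -> w0 u = 0 -> h u != 0 ->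
  dual_density p' s u = +oo%E.
Proof.
move=> s0 p'0 w00 hn0; rewrite /dual_density /epow w00 eqxx oppr_lt0 s0 /=.
rewrite gt0_muley// lte_fin powR_gt0// lt_def hn0; exact: h_ge0.
Qed.

Lemma dual_density_pos p' s u : w0 u != 0 ->
  dual_density p' s u = (h u `^ p' * (w0 u)^-1 `^ s)%:E.
Proof.
move=> wn0; rewrite /dual_density /epow (negPf wn0) /= -EFinM; congr (_ * _)%:E.
by rewrite -powR_inv1// -powRrM mulN1r.
Qed.

Lemma le_dual_density p' s u : 0 < s ->
  ((h u `^ p' * (w0 u)^-1 `^ s)%:E <= dual_density p' s u)%E.
Proof.
move=> s0; have [w00|wn0] := eqVneq (w0 u) 0.
  rewrite w00 invr0 powR0 ?gt_eqF// mulr0 mule_ge0 ?epow_ge0//.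
  by rewrite lee_fin powR_ge0.
by rewrite dual_density_pos.
Qed.

Let zero_set := [set u : Cn | w0 u = 0 /\ h u != 0].

Let mzero_set : measurable zero_set.
Proof.
have -> : zero_set = [set u | w0 u = 0] `\` [set u | h u = 0].
  apply/seteqP; split=> u /=; first by case=> ? /eqP.
  by case=> ? /eqP.
apply: measurableD.
- rewrite -[X in measurable X]setTI.
  exact: (mw0 measurableT (measurable_set1 (0 : R))).
- rewrite -[X in measurable X]setTI.
  exact: (mh measurableT (measurable_set1 (0 : R))).
Qed.

Section sufficiency.
Variable C : R.
Hypothesis C_ge1 : 1 <= C.
Hypothesis w0_doubling : forall z,
  (\int[vol R n]_(u in cube z (2 * r)) (w0 u)%:E <= C%:E * W z)%E.

Lemma toeplitz_bounded_null p : 0 < p -> {ae vol R n, forall z, w0 z = 0} ->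
  toeplitz_bounded alpha p w phi.
Proof.
move=> p0 w00.
have wz : {ae vol R n, forall z, w z = 0} by apply: filterS2 ww0 w00 => z -> ->.
have fi0 f : fock_int alpha p w f = 0%E.
  rewrite fock_intE -(integral0 (vol R n) setT); apply: ae_eq_lower_integral => //.
  - by move=> u _; rewrite lee_fin mulr_ge0// powR_ge0.
  - by apply: filterS wz => u -> _; rewrite mulr0.
exists 0 => // f _; split.
- exists setT; split=> //; rewrite /wmeas -(integral0 (vol R n) setT).
  apply: ae_eq_lower_integral => //.
  + by move=> u _; rewrite lee_fin.
  + by apply: filterS wz => u ->.
- by rewrite /fock_norm !fi0 poweR0r ?mule0// invr_eq0 gt_eqF.
Qed.

Lemma cube_mass_dichotomy :
  (forall z, 0 < cube_mass z) \/ {ae vol R n, forall z, w0 z = 0}.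
Proof.
have [H|/existsNP[z /negP]] := pselect (forall z, 0 < cube_mass z); first by left.
rewrite -leNgt => cz; right.
apply: (weight_ae0 alpha_gt0 r_gt0 C_ge1 mw0 w0_ge0 W_fin w0_doubling (z0 := z)).
by apply/eqP; rewrite eq_le cz cube_mass_ge0.
Qed.

(** When [w0] vanishes and [phi0] does not, the dual density is infinite, so the
finiteness of its averages makes that set null. The bound on averages is then the
hypothesis of [kop_bounded_gt1] solved for the integral of the dual density,
i.e. raised to the power [p' / p]. *)
Lemma toeplitz_bounded_gt1 (p p' S : R) : 1 < p -> p^-1 + p'^-1 = 1 -> 0 <= S ->
  (forall z, average (cube z r) (fun u => (w u)%:E) *
     average (cube z r) (fun u => (Normc.normc (phi u) `^ p')%:E *
        epow (w u) (- (p' / p))) `^ (p / p') <= S%:E)%E ->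
  toeplitz_bounded alpha p w phi.
Proof.
move=> p1 pq S0 HS.
have p0 : 0 < p by apply: lt_trans p1.
have p'0 : 0 < p' := conjugate_gt0 p1 pq.
have [c0|w00] := cube_mass_dichotomy; last exact: toeplitz_bounded_null.
set s := p' / p in HS; have s0 : 0 < s by rewrite divr_gt0.
pose B := V * V `^ s * S `^ s.
have B0 : 0 <= B by rewrite !mulr_ge0 ?powR_ge0// ltW.
pose J x := (\int[vol R n]_(u in cube x r) dual_density p' s u)%E.
have J0 x : (0 <= J x)%E.
  by apply: integral_ge0 => u _; rewrite mule_ge0 ?epow_ge0// lee_fin powR_ge0.
have JB x : (J x <= (B / cube_mass x `^ s)%:E)%E.
  have := HS x; rewrite average_weight average_dual -/(J x) => Hx.
  have Vc0 : 0 < V^-1 * cube_mass x by rewrite mulr_gt0 ?invr_gt0.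
  have VJ0 : (0 <= V^-1%:E * J x)%E by rewrite mule_ge0// lee_fin invr_ge0 ltW.
  have := le_poweR (ltW s0) _ Hx.
  rewrite (@poweRM _ _ _ s) ?poweR_ge0 ?lee_fin ?(ltW Vc0)// -poweRrM.
  rewrite (_ : p / p' * s = 1); last by rewrite /s; field; rewrite !gt_eqF.
  rewrite poweRe1// !poweR_EFin muleA -EFinM.
  rewrite mule_ge0 ?poweR_ge0 ?lee_fin ?(ltW Vc0)// => /(_ isT).
  set k := (_ `^ s * _)%R; have k0 : 0 < k by rewrite mulr_gt0 ?invr_gt0// powR_gt0.
  rewrite muleC -lee_pdivlMr// => /le_trans; apply.
  rewrite -EFinM lee_fin /k /B powRM ?invr_ge0 ?(ltW V_gt0) ?(ltW (c0 x))//.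
  have := powR_gt0 s V_gt0; have := powR_gt0 s (c0 x).
  have -> : V^-1 `^ s = (V `^ s)^-1.
    by rewrite -powR_inv1 ?(ltW V_gt0)// -powRrM mulN1r powRN.
  move: (cube_mass x `^ s) (V `^ s) (S `^ s) => a b c a0 b0.
  rewrite le_eqVlt; apply/orP; left; apply/eqP; field.
  by rewrite !gt_eqF.
apply: (toeplitz_bounded_of_kop alpha_gt0 p0 w_ge0 mw0 mphi0 w0_ge0 ww0 phiphi0).
apply: (kop_bounded_gt1 alpha_gt0 r_gt0 C_ge1 mw0 w0_ge0 mh h_ge0 W_fin
  w0_doubling c0 p1 pq B0).
- have : {ae vol R n, forall u, ~ zero_set u}.
    apply: null_of_cubes => // x.
    have : (\int[vol R n]_(u in cube x r) (+oo * (\1_zero_set u)%:E) < +oo)%E.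
      apply: le_lt_trans (le_lt_trans (JB x) (ltry _)).
      apply: le_lower_integral => u _; first by rewrite mule_ge0 ?lee_fin.
      rewrite indicE; have [/set_mem[wu hu]|_] := boolP (u \in zero_set).
        by rewrite mule1 dual_density_zero.
      by rewrite mule0 mule_ge0 ?epow_ge0// lee_fin powR_ge0.
    rewrite ge0_integralZl//.
    + have : (0 <= \int[vol R n]_(u in cube x r) (\1_zero_set u)%:E)%E.
        by apply: integral_ge0 => u _; rewrite lee_fin.
      rewrite le_eqVlt => /predU1P[<-//|i0].
      by rewrite gt0_mulye.
    + exact: measurable_cube.
    + by apply: measurable_funTS; exact: (measurable_indic_comp (f := id)).
  apply: filterS => u; rewrite /zero_set /= => Au wu.
  by apply/eqP; apply: contrapT => /negP hu; apply: Au.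
- move=> x; apply: le_trans (JB x); apply: le_lower_integral => u _.
    by rewrite lee_fin mulr_ge0// powR_ge0.
  exact: le_dual_density.
Qed.

(** On [cube x r] the condition reads [h <= S V w0 / cube_mass x], and [cube_mass u] is at
most [C cube_mass x] there; as [x] is arbitrary the resulting inequality between [h]
and [w0] holds almost everywhere. *)
Lemma toeplitz_bounded_eq1 (S : R) : 0 <= S ->
  (forall z, average (cube z r) (fun u => (w u)%:E) *
     ess_sup (vol R n) ((fun u => (Normc.normc (phi u))%:E * epow (w u) (-1))
                      \_ (cube z r)) <= S%:E)%E ->
  toeplitz_bounded alpha 1 w phi.
Proof.
move=> S0 HS; have [c0|w00] := cube_mass_dichotomy; last exact: toeplitz_bounded_null.
pose B := C * (S * V).
have CC : 0 < C by apply: lt_le_trans C_ge1.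
have B0 : 0 <= B by rewrite !mulr_ge0// ltW.
apply: (toeplitz_bounded_of_kop alpha_gt0 ltr01 w_ge0 mw0 mphi0 w0_ge0 ww0 phiphi0).
apply: (kop_bounded_eq1 alpha_gt0 r_gt0 C_ge1 mw0 w0_ge0 h_ge0 W_fin
  w0_doubling c0 B0).
pose A := [set u | B * w0 u < h u * cube_mass u].
have mA : measurable A.
  have -> : A = ~` [set u | h u * cube_mass u <= B * w0 u].
    by apply/seteqP; split=> u; rewrite /A /= ltNge => /negP.
  apply: measurableC; rewrite -[X in measurable X]setTI.
  apply: measurable_fun_le => //; apply: measurable_funM => //.
  exact: measurable_cube_mass.
suff : {ae vol R n, forall u, ~ A u} by apply: filterS => u /negP; rewrite -leNgt.
apply: null_of_cubes => // x.
rewrite -(integral0 (vol R n) (cube x r)).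
apply: ae_eq_lower_integral => [u _|//|]; first by rewrite lee_fin.
have := HS x; rewrite average_weight.
set F := _ \_ _; have Vc0 : 0 < V^-1 * cube_mass x by rewrite mulr_gt0 ?invr_gt0.
rewrite muleC -lee_pdivlMr// -EFinM => HF.
have Fae := ess_sup_ge (vol R n) F.
apply: filterS3 ww0 phiphi0 Fae => u wu pu Fu xu.
have {Fu} := le_trans Fu HF; rewrite /F patchE mem_set// wu pu => Fu.
rewrite indicE memNset//; rewrite /A /=; apply/negP; rewrite -leNgt.
have [w00|wn0] := eqVneq (w0 u) 0.
  have [-> |hn0] := eqVneq (h u) 0; first by rewrite mul0r mulr_ge0.
  move: Fu; rewrite /epow w00 eqxx oppr_lt0 ltr01 /= gt0_muley ?leye_eq//.
  by rewrite lte_fin lt_def hn0 normc_ge0.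
move: Fu; rewrite /epow (negPf wn0) /= powR_inv1// -EFinM lee_fin.
have wp : 0 < w0 u by rewrite lt_def wn0 w0_ge0.
have cu := cube_mass_near mw0 w0_ge0 W_fin w0_doubling xu.
rewrite (_ : S / (V^-1 * cube_mass x) = S * V / cube_mass x); last first.
  by field; rewrite !gt_eqF.
rewrite ler_pdivlMr// mulrAC ler_pdivrMr// => H.
apply: (@le_trans _ _ (h u * (C * cube_mass x))); first by rewrite ler_wpM2l.
by rewrite mulrCA /B -(mulrA C) ler_pM2l.
Qed.

End sufficiency.

Section necessity.
Variable M : R.
Hypothesis phi0_le : forall u, h u <= M.

Lemma ae_not_of_integral0 (D A : set Cn) (g : Cn -> R) :
  measurable D -> measurable A -> measurable_fun setT g ->
  (forall u, A u -> 0 < g u) ->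
  (\int[vol R n]_(u in D) (g u * \1_A u)%:E <= 0)%E ->
  {ae vol R n, forall u, D u -> ~ A u}.
Proof.
move=> mD mA mg gA ig.
have gA0 u : 0 <= g u * \1_A u.
  rewrite indicE; have [/set_mem/gA/ltW|] := boolP (u \in A).
    by rewrite mulr1.
  by rewrite mulr0.
have m1 : measurable_fun setT (\1_A : Cn -> R) by exact: measurable_indic.
have mgA : measurable_fun D (fun u => (g u * \1_A u)%:E).
  by apply: measurable_funTS; apply/measurable_EFinP; exact: measurable_funM.
have : (\int[vol R n]_(u in D) `|(g u * \1_A u)%:E| = 0)%E.
  apply/eqP; rewrite eq_le integral_ge0// andbT; apply: le_trans ig.
  by apply: le_lower_integral => // u _; rewrite gee0_abs// lee_fin.
move=> /(ae_eq_integral_abs _ mD mgA); apply: filterS => u + Du Au => /(_ Du) [] /eqP.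
by rewrite indicE mem_set// mulr1 gt_eqF// gA.
Qed.

(** The test density is the indicator of the set [A] where
[K w0 < cube_mass x * h]: the inequality [cube_mass x * int_A h <= K * int_A w0] makes it
null. *)
Lemma cube_condition_eq1 : toeplitz_bounded alpha 1 w phi ->
  exists2 S : R, 0 <= S & forall z,
    (average (cube z r) (fun u => (w u)%:E) *
     ess_sup (vol R n) ((fun u => (Normc.normc (phi u))%:E * epow (w u) (-1))
                      \_ (cube z r)) <= S%:E)%E.
Proof.
move=> /(toeplitz_bounded_test alpha_gt0 r_gt0 ltr01 w_ge0 mw0 mphi0 w0_ge0 ww0
  phiphi0 phi0_le) [K K0 test].
exists (V^-1 * K); first by rewrite mulr_ge0// invr_ge0 ltW.
move=> x; rewrite average_weight.
have [->|cn0] := eqVneq (cube_mass x) 0.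
  by rewrite mulr0 mul0e lee_fin mulr_ge0// invr_ge0 ltW.
have c0 : 0 < cube_mass x by rewrite lt_def cn0 cube_mass_ge0.
suff essK : (ess_sup (vol R n) ((fun u => (Normc.normc (phi u))%:E * epow (w u) (-1))
                      \_ (cube x r)) <= (K / cube_mass x)%:E)%E.
  apply: le_trans (lee_wpmul2l _ essK) _.
    by rewrite lee_fin mulr_ge0 ?invr_ge0// ltW.
  rewrite -EFinM lee_fin le_eqVlt; apply/orP; left; apply/eqP; field.
  by rewrite !gt_eqF.
pose A := [set u | K * w0 u < cube_mass x * h u].
have mg : measurable_fun setT (fun u => cube_mass x * h u - K * w0 u).
  by apply: measurable_funB; exact: measurable_funM.
have mA : measurable A.
  have -> : A = ~` [set u | cube_mass x * h u <= K * w0 u].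
    by apply/seteqP; split=> u; rewrite /A /= ltNge => /negP.
  apply: measurableC; rewrite -[X in measurable X]setTI.
  by apply: measurable_fun_le => //; exact: measurable_funM.
have m1 : measurable_fun setT (\1_A : Cn -> R) by exact: measurable_indic.
have mcube := measurable_cube x r.
have Aae : {ae vol R n, forall u, cube x r u -> ~ A u}.
  apply: (ae_not_of_integral0 mcube mA mg) => [u|]; first by rewrite /A /= subr_gt0.
  have wA_fin : (\int[vol R n]_(u in cube x r) (w0 u * \1_A u)%:E < +oo)%E.
    apply: le_lt_trans (W_fin x); apply: le_lower_integral => u _.
      by rewrite lee_fin mulr_ge0.
    by rewrite lee_fin indicE ler_piMr// lern1 leq_b1.
  have psiE : (\int[vol R n]_(u in cube x r) (\1_A u `^ 1 * w0 u)%:E =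
      \int[vol R n]_(u in cube x r) (w0 u * \1_A u)%:E)%E.
    by apply: eq_integral => u _; rewrite powRr1// mulrC.
  have := test x \1_A 1 m1 (fun u => _) (fun u => _).
  rewrite psiE => /(_ _ _ wA_fin).
  rewrite poweRe1; last first.
    by apply: integral_ge0 => u _; rewrite lee_fin mulr_ge0 ?normc_ge0.
  rewrite cube_massE// => HA.
  have {}HA : ((cube_mass x)%:E * \int[vol R n]_(u in cube x r) (h u * \1_A u)%:E <=
    K%:E * \int[vol R n]_(u in cube x r) (w0 u * \1_A u)%:E)%E.
    by apply: HA => u; rewrite // indicE lern1 leq_b1.
  have mh1 (g : Cn -> R) : measurable_fun setT g ->
      measurable_fun (cube x r) (fun u => (g u * \1_A u)%:E).
    move=> mg'; apply: measurable_funTS; apply/measurable_EFinP.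
    exact: measurable_funM.
  have gA0 u : 0 <= (cube_mass x * h u - K * w0 u) * \1_A u.
    rewrite indicE; have [/set_mem Au|_] := boolP (u \in A); last by rewrite mulr0.
    by rewrite mulr1 subr_ge0 ltW.
  have sumE : (\int[vol R n]_(u in cube x r) ((cube_mass x * h u - K * w0 u) * \1_A u)%:E +
     K%:E * \int[vol R n]_(u in cube x r) (w0 u * \1_A u)%:E =
     (cube_mass x)%:E * \int[vol R n]_(u in cube x r) (h u * \1_A u)%:E)%E.
    rewrite -!ge0_integralZl//; try exact: mh1.
    - rewrite -ge0_integralD//.
      + by apply: eq_integral => u _; rewrite -!EFinM -EFinD; congr EFin; ring.
      + by move=> u _; rewrite lee_fin.
      + exact: mh1.
      + by move=> u _; rewrite -EFinM lee_fin !mulr_ge0.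
      + by apply: emeasurable_funM => //; exact: mh1.
    - by move=> u _; rewrite lee_fin mulr_ge0 ?normc_ge0.
    - by rewrite lee_fin ltW.
    - by move=> u _; rewrite lee_fin mulr_ge0.
  have Kfin : (K%:E * \int[vol R n]_(u in cube x r) (w0 u * \1_A u)%:E)%E \is a fin_num.
    rewrite fin_numM// ge0_fin_numE// integral_ge0// => u _.
    by rewrite lee_fin mulr_ge0.
  by move: HA; rewrite -sumE -leeBrDr// subee.
apply/ess_supP; apply: filterS3 ww0 phiphi0 Aae => u wu pu Au.
rewrite patchE; case: ifPn => [/set_mem xu|_]; last first.
  by rewrite lee_fin divr_ge0// ltW.
have := Au xu; rewrite wu pu /A /= => /negP; rewrite -leNgt => H.
have [w00|wn0] := eqVneq (w0 u) 0.
  have -> : h u = 0.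
    move: H; rewrite w00 mulr0 pmulr_rle0// => hu.
    by apply/eqP; rewrite eq_le hu normc_ge0.
  by rewrite mul0e lee_fin divr_ge0// ltW.
have wp : 0 < w0 u by rewrite lt_def wn0 w0_ge0.
rewrite /epow (negPf wn0) /= powR_inv1// -EFinM lee_fin.
by rewrite ler_pdivlMr// mulrAC ler_pdivrMr// mulrC.
Qed.

(** The extremal density is [(h / w0)^(p'/p)], for which [psi^p w0 = h psi] is the
dual density; the inequality [cube_mass x * I^p <= K * I] for the common integral [I]
then gives [cube_mass x * I^(p-1) <= K], with [p - 1 = p / p']. To divide by [I] one
needs it finite, so the density is truncated to the sets where [h / w0 <= m], and [m]
goes to infinity. The points with [w0 = 0 < h], where the dual density is
infinite, are excluded by a first test. *)
Lemma cube_condition_gt1 (p p' : R) : 1 < p -> p^-1 + p'^-1 = 1 ->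
  toeplitz_bounded alpha p w phi ->
  exists2 S : R, 0 <= S & forall z,
    (average (cube z r) (fun u => (w u)%:E) *
     average (cube z r) (fun u => (Normc.normc (phi u) `^ p')%:E *
        epow (w u) (- (p' / p))) `^ (p / p') <= S%:E)%E.
Proof.
move=> p1 pq TB.
have p0 : 0 < p by apply: lt_trans p1.
have p'0 : 0 < p' := conjugate_gt0 p1 pq.
have [K K0 test] := toeplitz_bounded_test alpha_gt0 r_gt0 p0 w_ge0 mw0 mphi0 w0_ge0
  ww0 phiphi0 phi0_le TB.
set s := p' / p; have s0 : 0 < s by rewrite divr_gt0.
set q := p / p'; have q0 : 0 < q by rewrite divr_gt0.
have p'n : p' != 0 by rewrite gt_eqF.
have pn : p != 0 by rewrite gt_eqF.
have ppE : p + p' = p * p'.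
  have : p * p' * (p^-1 + p'^-1) = p * p' by rewrite pq mulr1.
  by move=> <-; field; rewrite pn p'n.
have qE : q = p - 1.
  by apply: (mulIf p'n); rewrite /q mulfVK// mulrBl mul1r -ppE addrK.
have sE : s = p' - 1.
  by apply: (mulIf pn); rewrite /s mulfVK// mulrBl mul1r mulrC -ppE addrAC subrr add0r.
have spE : s * p = p' by rewrite /s mulfVK.
exists (V^-1 * V^-1 `^ q * K).
  by rewrite !mulr_ge0 ?powR_ge0// invr_ge0 ltW.
move=> x; rewrite average_weight average_dual.
have KV0 : 0 <= V^-1 * V^-1 `^ q * K.
  by rewrite !mulr_ge0 ?powR_ge0// invr_ge0 ltW.
have [->|cn0] := eqVneq (cube_mass x) 0; first by rewrite mulr0 mul0e lee_fin.
have c0 : 0 < cube_mass x by rewrite lt_def cn0 cube_mass_ge0.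
have mcube := measurable_cube x r.
set J := integral _ _ (dual_density p' s).
have J0 : (0 <= J)%E.
  by apply: integral_ge0 => u _; rewrite mule_ge0 ?epow_ge0// lee_fin powR_ge0.
suff JT : (J <= ((K / cube_mass x) `^ q^-1)%:E)%E.
  have Jq : (J `^ q <= (K / cube_mass x)%:E)%E.
    apply: le_trans (le_poweR (ltW q0) J0 JT) _.
    rewrite poweR_EFin -powRrM mulVf ?gt_eqF// powRr1//.
    by rewrite divr_ge0// ltW.
  rewrite poweRM ?lee_fin ?invr_ge0 ?(ltW V_gt0)// poweR_EFin muleA -EFinM.
  apply: le_trans (lee_wpmul2l _ Jq) _.
    by rewrite lee_fin !mulr_ge0 ?powR_ge0 ?invr_ge0// ltW.
  rewrite -EFinM lee_fin le_eqVlt; apply/orP; left; apply/eqP; field.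
  by rewrite !gt_eqF.
(* the first test: on [zero_set] the right-hand side [int psi^p w0] is 0 *)
have Zae : {ae vol R n, forall u, cube x r u -> ~ zero_set u}.
  have m1 : measurable_fun setT (\1_zero_set : Cn -> R) by exact: measurable_indic.
  apply: (ae_not_of_integral0 mcube mzero_set mh) => [u [_ hu]|].
    by rewrite lt_def hu h_ge0.
  have z0 : (\int[vol R n]_(u in cube x r) (\1_zero_set u `^ p * w0 u)%:E = 0)%E.
    rewrite -(integral0 (vol R n) (cube x r)); apply: eq_integral => u _.
    rewrite indicE; have [/set_mem[-> _]|_] := boolP (u \in zero_set).
      by rewrite mulr0.
    by rewrite powR0// mul0r.
  have zfin : (\int[vol R n]_(u in cube x r) (\1_zero_set u `^ p * w0 u)%:E < +oo)%E.
    by rewrite z0.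
  have := test x \1_zero_set 1 m1 (fun u => _) (fun u => _) zfin.
  rewrite z0 mule0 cube_massE// => H.
  have {}H : ((cube_mass x)%:E *
    (\int[vol R n]_(u in cube x r) (h u * \1_zero_set u)%:E) `^ p <= 0)%E.
    by apply: H => u; rewrite // indicE lern1 leq_b1.
  move: H; rewrite pmule_rle0 ?lte_fin// => H.
  have : ((\int[vol R n]_(u in cube x r) (h u * \1_zero_set u)%:E) `^ p = 0)%E.
    by apply/eqP; rewrite eq_le H poweR_ge0.
  move=> /poweR_eq0_eq0 ->//.
  by apply: integral_ge0 => u _; rewrite lee_fin mulr_ge0.
pose rho u := h u / w0 u.
have rho0 u : 0 <= rho u by rewrite divr_ge0.
have mrho : measurable_fun setT rho.
  by apply: measurable_funM => //; exact: measurable_inv_ge0.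
pose E (m : nat) := [set u : Cn | rho u <= m%:R].
have mE m : measurable (E m).
  by rewrite -[E m]setTI; apply: measurable_fun_le.
pose psi m u := rho u `^ s * \1_(E m) u.
have psi0 m u : 0 <= psi m u by rewrite mulr_ge0// powR_ge0.
have mpsi m : measurable_fun setT (psi m).
  apply: measurable_funM; last exact: measurable_indic.
  exact: (measurableT_comp (measurable_powR s)).
have psi_le m u : psi m u <= m%:R `^ s.
  rewrite /psi indicE; have [/set_mem Eu|_] := boolP (u \in E m).
    by rewrite mulr1 ge0_ler_powR ?nnegrE// ltW.
  by rewrite mulr0 powR_ge0.
have hpsi m u : psi m u `^ p * w0 u = h u * psi m u.
  rewrite /psi powRM ?powR_ge0// -powRrM spE.
  have -> : (\1_(E m) u : R) `^ p = \1_(E m) u.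
    by rewrite indicE; case: (_ \in _); rewrite ?powR1// powR0.
  have [w00|wn0] := eqVneq (w0 u) 0.
    by rewrite /rho w00 invr0 !mulr0 powR0 ?gt_eqF// mul0r mulr0.
  rewrite -(mulr_powRB1 (rho0 u) p'0) -sE mulrAC mulrA; congr (_ * _).
  by rewrite mulrAC; congr (_ * _); rewrite /rho mulfVK.
pose I m := (\int[vol R n]_(u in cube x r) (h u * psi m u)%:E)%E.
have IE m : (\int[vol R n]_(u in cube x r) (psi m u `^ p * w0 u)%:E = I m)%E.
  by apply: eq_integral => u _; rewrite hpsi.
have I0 m : (0 <= I m)%E.
  by apply: integral_ge0 => u _; rewrite lee_fin mulr_ge0.
have Ifin m : (I m < +oo)%E.
  rewrite -IE; apply: (@le_lt_trans _ _ (\int[vol R n]_(u in cube x r)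
    ((m%:R `^ s `^ p)%:E * (w0 u)%:E))%E).
    apply: le_lower_integral => u _; first by rewrite lee_fin mulr_ge0// powR_ge0.
    rewrite -EFinM lee_fin ler_wpM2r// ge0_ler_powR ?nnegrE ?powR_ge0//.
    exact: ltW.
  rewrite ge0_integralZl//.
  - by rewrite lte_mul_pinfty ?lee_fin ?powR_ge0.
  - by apply/measurable_EFinP; exact: measurable_funTS.
  - by move=> u _; rewrite lee_fin.
have IT m : (I m <= ((K / cube_mass x) `^ q^-1)%:E)%E.
  have := test x (psi m) _ (mpsi m) (psi0 m) (psi_le m).
  rewrite IE => /(_ (Ifin m)); rewrite cube_massE//.
  rewrite -/(I m); have := I0 m.
  have fm : I m \is a fin_num by rewrite ge0_fin_numE.
  rewrite -(fineK fm); move: (fine (I m)) => i.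
  rewrite lee_fin le_eqVlt => /predU1P[<- _|i0]; first by rewrite lee_fin powR_ge0.
  rewrite poweR_EFin -!EFinM !lee_fin.
  rewrite -(mulr_powRB1 (ltW i0) p0) -qE mulrCA mulrC ler_pM2r// => H.
  have {}H : i `^ q <= K / cube_mass x by rewrite ler_pdivlMr// mulrC.
  have := @ge0_ler_powR R q^-1 _ _ _ _ _ H.
  rewrite -powRrM mulfV ?gt_eqF// powRr1 ?(ltW i0)//.
  by apply; rewrite ?nnegrE ?invr_ge0 ?powR_ge0 ?divr_ge0// ltW.
pose g m u := (h u * psi m u)%:E.
have JE : J = (\int[vol R n]_(u in cube x r) limn (g ^~ u))%E.
  have lim_g u : limn (g ^~ u) = (h u * rho u `^ s)%:E.
    apply: cvg_lim => //; apply: (cvg_near_cst); near=> m.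
    rewrite /g /psi indicE mem_set ?mulr1//.
    rewrite /E /=; near: m; exists (Num.truncn (rho u)).+1 => // m /= um.
    by apply: le_trans (ltW (truncnS_gt _)) _; rewrite ler_nat.
  apply: ae_eq_lower_integral => [u _|u _|].
  - by rewrite mule_ge0 ?epow_ge0// lee_fin powR_ge0.
  - by rewrite lim_g lee_fin mulr_ge0// powR_ge0.
  apply: filterS Zae => u Zu xu; rewrite lim_g.
  have [w00|wn0] := eqVneq (w0 u) 0.
    have hu : h u = 0 by apply/eqP; apply: contrapT => /negP hu; exact: Zu.
    by rewrite /dual_density hu powR0// mul0e mul0r.
  rewrite -[LHS]/(dual_density p' s u) dual_density_pos// /rho powRM ?invr_ge0// mulrA; congr (_ * _)%:E.
  by rewrite sE mulr_powRB1.
rewrite JE monotone_convergence//.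
- apply: lime_le; last by apply: nearW => m; exact: IT.
  apply: ereal_nondecreasing_is_cvgn => a b ab.
  apply: le_lower_integral => u _; first by rewrite lee_fin mulr_ge0.
  rewrite lee_fin ler_wpM2l// ler_wpM2l ?powR_ge0// !indicE ler_nat.
  have [/set_mem Eu|//] := boolP (u \in E a).
  by rewrite mem_set// /E /= (le_trans Eu)// ler_nat.
- by move=> m; apply/measurable_EFinP; apply: measurable_funTS; exact: measurable_funM.
- by move=> m u _; rewrite lee_fin mulr_ge0.
- move=> u _ a b ab; rewrite lee_fin ler_wpM2l// ler_wpM2l ?powR_ge0// !indicE ler_nat.
  have [/set_mem Eu|//] := boolP (u \in E a).
  by rewrite mem_set// /E /= (le_trans Eu)// ler_nat.
Unshelve. all: by end_near. Qed.

End necessity.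

End criteria.

(** * Borel representatives and the theorem *)

Section borel_representatives.
Variables (R : realType) (n : nat).
Local Notation Cn := (Cspace R n).

Lemma weight_representative (w : Cn -> R) : is_weight w ->
  exists2 w0 : Cn -> R, measurable_fun setT w0 /\ (forall z, 0 <= w0 z) &
    {ae vol R n, forall z, w z = w0 z}.
Proof.
move=> [[w1 mw1 ww1] w_ge0 _]; exists (fun z => `|w1 z|).
  by split => //; apply: measurableT_comp.
by apply: filterS ww1 => z <-; rewrite ger0_norm.
Qed.

(** Truncating a Borel representative at the essential supremum makes it bounded
everywhere, which the integrability of the test functions uses. *)
Lemma Linfty_representative (phi : Cn -> R[i]) : Linfty phi ->
  exists2 phi0 : Cn -> R[i], measurable_fun setT phi0 /\
      (exists M : R, forall z, Normc.normc (phi0 z) <= M) &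
    {ae vol R n, forall z, phi z = phi0 z}.
Proof.
move=> [[phi1 mphi1 phiphi1] fin].
set e := ess_sup _ _ in fin.
have [M M0 eM] : exists2 M : R, 0 <= M & (e <= M%:E)%E.
  exists (Num.max 0 (fine e)); first by rewrite le_max lexx.
  case: e fin => [x| |]//= _; last by rewrite leNye.
  by rewrite lee_fin le_max lexx orbT.
have mn : measurable_fun setT (fun z => Normc.normc (phi1 z)).
  exact: measurable_normc_comp.
pose A := [set z | Normc.normc (phi1 z) <= M].
have mA : measurable A by rewrite -[A]setTI; exact: measurable_fun_le.
exists (fun z => (\1_A z)%:C * phi1 z); first split.
- apply: measurable_mulc => //; apply: measurable_complexP => //=.
  exact: measurable_indic.
- exists M => z; rewrite Normc.normcM normc_real// indicE.
  have [/set_mem Az|_] := boolP (z \in A); first by rewrite mul1r.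
  by rewrite mul0r.
have /= Fae := ess_sup_ge (vol R n) (fun z => (Normc.normc (phi z))%:E).
apply: filterS2 phiphi1 Fae => z pz Fz.
rewrite indicE mem_set ?mul1r// /A /= -pz -lee_fin.
exact: le_trans Fz eM.
Qed.

End borel_representatives.

Theorem theorem1p2 (R : realType) (n : nat) (n_gt0 : (0 < n)%N)
    (alpha : R) (alpha_gt0 : 0 < alpha)
    (phi : Cspace R n -> R[i]) (phi_Linfty : Linfty phi)
    (r : R) (r_gt0 : 0 < r)
    (w : Cspace R n -> R) (w_weight : is_weight w) (w_doubling : r_doubling r w) :
  (forall p p' : R, 1 < p -> p^-1 + p'^-1 = 1 ->
     toeplitz_bounded alpha p w phi <->
     (ereal_sup [set average (cube z r) (fun u => (w u)%:E) *
                     average (cube z r) (fun u =>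
                       (Normc.normc (phi u) `^ p')%:E * epow (w u) (- (p' / p)))
                     `^ (p / p')
                | z in [set: Cspace R n]] < +oo)%E)
  /\
  (toeplitz_bounded alpha 1 w phi <->
   (ereal_sup [set average (cube z r) (fun u => (w u)%:E) *
                   ess_sup (vol R n)
                     ((fun u => (Normc.normc (phi u))%:E * epow (w u) (-1))
                      \_ (cube z r))
              | z in [set: Cspace R n]] < +oo)%E).
Proof.
have [w0 [mw0 w0_ge0] ww0] := weight_representative w_weight.
have [phi0 [mphi0 [M phi0_le]] phiphi0] := Linfty_representative phi_Linfty.
have [_ w_ge0 w_fin] := w_weight.
have wE z s : wmeas w (cube z s) = (\int[vol R n]_(u in cube z s) (w0 u)%:E)%E.
  apply: ae_eq_lower_integral => [u _|u _|]; rewrite ?lee_fin//.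
  by apply: filterS ww0 => u ->.
have W_fin z : (\int[vol R n]_(u in cube z r) (w0 u)%:E < +oo)%E by rewrite -wE.
have [C C_ge1 dbl] := w_doubling.
have w0_doubling z : (\int[vol R n]_(u in cube z (2 * r)) (w0 u)%:E <=
    C%:E * \int[vol R n]_(u in cube z r) (w0 u)%:E)%E by rewrite -!wE.
split=> [p p' p1 pq|]; split.
- move=> TB; apply/ereal_sup_ltyP.
  exact: (cube_condition_gt1 alpha_gt0 r_gt0 w_ge0 mw0 mphi0 w0_ge0 ww0 phiphi0 W_fin
    phi0_le p1 pq TB).
- move=> /ereal_sup_ltyP[S S0 HS].
  exact: (toeplitz_bounded_gt1 alpha_gt0 r_gt0 w_ge0 mw0 mphi0 w0_ge0 ww0 phiphi0
    W_fin C_ge1 w0_doubling p1 pq S0 HS).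
- move=> TB; apply/ereal_sup_ltyP.
  exact: (cube_condition_eq1 alpha_gt0 r_gt0 w_ge0 mw0 mphi0 w0_ge0 ww0 phiphi0 W_fin
    phi0_le TB).
- move=> /ereal_sup_ltyP[S S0 HS].
  exact: (toeplitz_bounded_eq1 alpha_gt0 r_gt0 w_ge0 mw0 mphi0 w0_ge0 ww0 phiphi0
    W_fin C_ge1 w0_doubling S0 HS).
Qed.
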